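(* Let $\mathscr{A}\subseteq(2\mathbb{N})^n$, $\mathscr{B}_1\subseteq\mathrm{conv}(\mathscr{A})\cap(2\mathbb{N})^n$ and $\mathscr{B}_2\subseteq\mathrm{conv}(\mathscr{A})\cap(\mathbb{N}^n\setminus(2\mathbb{N})^n)$ be finite sets with $\mathscr{A}\cap\mathscr{B}_1=\varnothing$. Then the convex cone $\mathrm{SONC}_{\mathscr{A},\mathscr{B}_1,\mathscr{B}_2}$ admits a second-order cone representation: it has an $(\mathbb{S}^2_+)^k$-lift for some $k\in\mathbb{N}$.
   Context: $\mathbb{N}=\{0,1,2,\dots\}$; $\mathrm{conv}$ denotes convex hull; $\mathbf{x}^{\alpha}=x_1^{\alpha_1}\cdots x_n^{\alpha_n}$. A circuit polynomial is a polynomial $\sum_{\alpha\in T}c_\alpha\mathbf{x}^\alpha-d\mathbf{x}^\beta\in\mathbb{R}[x_1,\dots,x_n]$ such that $T\subseteq(2\mathbb{N})^n$ is the vertex set of a simplex (a finite affinely independent set), $c_\alpha>0$ for all $\alpha\in T$, $d\in\mathbb{R}$, and $\beta\in\mathbb{N}^n$ lies in the relative interior of $\mathrm{conv}(T)$. A nonnegative circuit polynomial is a circuit polynomial that is nonnegative on $\mathbb{R}^n$; monomial squares $c\mathbf{x}^\alpha$ ($c\ge0$, $\alpha\in(2\mathbb{N})^n$) are also counted as nonnegative circuit polynomials. $\mathrm{SONC}$ is the set of finite sums of nonnegative circuit polynomials. The SONC cone supported on $\mathscr{A},\mathscr{B}_1,\mathscr{B}_2$ is $$\mathrm{SONC}_{\mathscr{A},\mathscr{B}_1,\mathscr{B}_2}=\Big\{\big((c_\alpha)_{\alpha\in\mathscr{A}},(d_\beta)_{\beta\in\mathscr{B}_1},(d_\beta)_{\beta\in\mathscr{B}_2}\big)\in\mathbb{R}_{\ge0}^{|\mathscr{A}|}\times\mathbb{R}_{\ge0}^{|\mathscr{B}_1|}\times\mathbb{R}^{|\mathscr{B}_2|}\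 \Big|\ \sum_{\alpha\in\mathscr{A}}c_\alpha\mathbf{x}^\alpha-\sum_{\beta\in\mathscr{B}_1\cup\mathscr{B}_2}d_\beta\mathbf{x}^\beta\in\mathrm{SONC}\Big\}.$$ $\mathbb{S}^2_+$ is the cone of real symmetric positive semidefinite $2\times2$ matrices, which is (up to a linear isomorphism) the 3-dimensional rotated second-order cone $\{(a_1,a_2,a_3)\in\mathbb{R}^3\mid 2a_1a_2\ge a_3^2,\ a_1\ge0,\ a_2\ge0\}$. A convex cone $C\subseteq\mathbb{R}^m$ has a $\mathcal{Q}^k$-lift, where $\mathcal{Q}^k=\mathcal{Q}\times\cdots\times\mathcal{Q}$ ($k$ copies) and $\mathcal{Q}$ is a second-order cone, if there are a linear subspace $L$ of the ambient space of $\mathcal{Q}^k$ and a linear map $\pi$ to $\mathbb{R}^m$ with $C=\pi(\mathcal{Q}^k\cap L)$. *)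

(* Defs.v *)
From HB Require Import structures.
From mathcomp Require Import all_boot all_order all_algebra finmap mpoly.
From mathcomp Require Import classical_sets reals.

Set Implicit Arguments.
Unset Strict Implicit.
Unset Printing Implicit Defensive.

Import Order.TTheory GRing.Theory Num.Theory.
Local Open Scope classical_set_scope.
Local Open Scope ring_scope.

Section Convexity.
Variable R : realType.

Definition conv_hull (V : lmodType R) (S : set V) : set V :=
  [set x | exists (k : nat) (p : 'I_k -> V) (w : 'I_k -> R),
     [/\ forall i, S (p i), forall i, 0 <= w i, \sum_i w i = 1
       & x = \sum_i w i *: p i]].

Definition aff_hull (V : lmodType R) (S : set V) : set V :=
  [set x | exists (k : nat) (p : 'I_k -> V) (w : 'I_k -> R),
     [/\ forall i, S (p i), \sum_i w i = 1 & x = \sum_i w i *: p i]].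

Definition affinely_independent (I : finType) (V : lmodType R) (p : I -> V) :=
  forall w : I -> R,
    \sum_i w i = 0 -> \sum_i w i *: p i = 0 -> forall i, w i = 0.

(* The balls are those of the sup norm, which induces the usual topology. *)
Definition relint (n : nat) (S : set 'rV[R]_n) : set 'rV[R]_n :=
  [set x | S x /\ exists2 e : R, 0 < e &
     forall y : 'rV[R]_n, aff_hull S y -> (forall i, `|y 0 i - x 0 i| < e) -> S y].

End Convexity.

Section SONC.
Variables (R : realType) (n : nat).
Implicit Types (m : 'X_{1..n}) (A : {fset 'X_{1..n}}).

Definition even_expt m := forall i, ~~ odd (m i).

Definition expt_pt m : 'rV[R]_n := \row_i (m i)%:R.

Definition conv_expt A : set 'rV[R]_n := conv_hull (expt_pt @` [set` A]).

Definition circuit (p : {mpoly R[n]}) :=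
  exists (T : {fset 'X_{1..n}}) (c : T -> R) (d : R) (b : 'X_{1..n}),
    [/\ forall a, a \in T -> even_expt a,
        affinely_independent (fun a : T => expt_pt (val a)),
        forall a : T, 0 < c a,
        relint (conv_expt T) (expt_pt b)
      & p = \sum_(a : T) c a *: 'X_[val a] - d *: 'X_[b]].

Definition nonneg (p : {mpoly R[n]}) := forall x : 'I_n -> R, 0 <= p.@[x].

Definition monomial_square (p : {mpoly R[n]}) :=
  exists (c : R) (a : 'X_{1..n}), [/\ 0 <= c, even_expt a & p = c *: 'X_[a]].

Definition nonneg_circuit (p : {mpoly R[n]}) :=
  (circuit p /\ nonneg p) \/ monomial_square p.

Definition sonc : set {mpoly R[n]} :=
  [set f | exists2 s : seq {mpoly R[n]},
     (forall p, p \in s -> nonneg_circuit p) & f = \sum_(p <- s) p].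

(* Splitting the sum over the union of B1 and B2 into two sums presupposes that
   B1 and B2 are disjoint; this is the case when B1 consists of even exponents
   and B2 of exponents that are not even. *)
Definition signed_poly (A B1 B2 : {fset 'X_{1..n}})
    (c : A -> R) (d1 : B1 -> R) (d2 : B2 -> R) : {mpoly R[n]} :=
  \sum_(a : A) c a *: 'X_[val a]
  - (\sum_(b : B1) d1 b *: 'X_[val b] + \sum_(b : B2) d2 b *: 'X_[val b]).

(* R^o makes the coefficient space a finite-dimensional vector space over R. *)
Definition sonc_cone (A B1 B2 : {fset 'X_{1..n}}) :=
  [set v : {ffun A -> R^o} * {ffun B1 -> R^o} * {ffun B2 -> R^o} |
     [/\ forall a : A, 0 <= v.1.1 a :> R,
         forall b : B1, 0 <= v.1.2 b :> R
       & sonc (signed_poly v.1.1 v.1.2 v.2)]].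

End SONC.

Section Lifts.
Variable R : realType.

Definition psd_cone (m : nat) : set 'M[R]_m :=
  [set M | M^T = M /\ forall u : 'rV[R]_m, 0 <= (u *m M *m u^T) 0 0].

(* The lift by the k-fold product of Q. If Q spans a proper subspace of U (as
   psd_cone does in 'M_m), then letting L range over the subspaces of all of
   {ffun 'I_k -> U} gives the same cones, since L can be intersected with the
   span of the product and linear maps extend from that span. *)
Definition has_lift (U W : vectType R) (Q : set U) (k : nat) (C : set W) :=
  exists (L : {vspace {ffun 'I_k -> U}}) (pi : 'Hom({ffun 'I_k -> U}, W)),
    C = pi @` [set u : {ffun 'I_k -> U} | (forall i, Q (u i)) /\ u \in L].

End Lifts.

Arguments sonc_cone R {n} A B1 B2.
Arguments psd_cone R m : clear implicits.

(* Main.v *)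
Require Import Defs.
From HB Require Import structures.
From mathcomp Require Import all_boot all_order all_algebra finmap mpoly.
From mathcomp Require Import classical_sets reals.
From mathcomp Require Import boolp topology normedtype sequences exp derive.
From mathcomp Require Import ring lra zify.

(** On the positive orthant, a circuit polynomial with its negative term at b is
    an age polynomial: it is nonnegative there and all its coefficients but that
    of b are nonnegative. The theorem rests on two facts about age polynomials.

    The first is that no cancellation is needed. If f is a sum of age polynomials
    q_b, one for each b, then [eliminate] adds multiples of the q_b to each other
    until every exponent at which f is nonpositive occurs in only one of them
    and every other exponent occurs with nonnegative coefficients only. Hence a
    point of the SONC cone, even if it is given by circuits with arbitrary
    supports, has a certificate made of one age polynomial for each b in B1 or
    B2, supported on A and b ([sonc_age_certificate]). An exponent b of B2 may be
    taken with either sign, since changing the sign of a coordinate changes the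
    sign of the monomial b.

    The second is that an age polynomial sum_a c_a x^a - d x^b splits into circuits
    with finitely many shapes. Dividing by x^b and setting x = exp(y) gives an
    exponential sum bounded below by d. After the terms that can be made to vanish
    at infinity are dropped, Stiemke's alternative makes the sum coercive, so it
    attains its minimum, and the values of its terms there are weights with
    barycenter b ([exp_tight_point]). By a conic Caratheodory argument these are
    combinations of integral weights carried by simplices, one fixed vector for
    each simplex ([simplicial_decomposition]). The polynomial is therefore, up to
    monomials with nonnegative coefficients, a nonnegative combination of finitely
    many AM-GM forms sum_a l_a x^a - L x^b, all composed with one diagonal scaling
    ([age_simplicial]). These forms are circuits, so a certificate gives back a
    point of the SONC cone ([age_certificate_sonc]).

    Finally, after the substitution of K-th powers for the variables an AM-GM form
    with integral weights is a sum of squares of binomials: for two points this is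
    a telescoping sum of second differences along a subdivided segment, and the
    general case adds one point at a time ([weighted_amgm_sobs]). Diagonal scalings
    preserve binomial squares and their exponents, so a single K and a single
    finite list M of exponents serve all the certificates ([age_sobs]). A sum of
    binomial squares with exponents in M is the image under a linear map of a
    family of 2 x 2 psd matrices indexed by pairs of exponents, and the remaining
    inequalities of a certificate, of the form 0 <= s and |w| <= t, are psd
    conditions on 2 x 2 matrices as well. *)

Set Implicit Arguments.
Unset Strict Implicit.
Unset Printing Implicit Defensive.

Import Order.TTheory GRing.Theory Num.Theory numFieldNormedType.Exports.
Local Open Scope ring_scope.

(** * Farkas' lemma and Stiemke's alternative *)

Section Farkas.
Variables (F : realFieldType) (n : nat).
Implicit Types (g u : 'rV[F]_n) (z : 'cV[F]_n).

Definition pairing u z : F := (u *m z) 0 0.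

Lemma pairingDl u u' z : pairing (u + u') z = pairing u z + pairing u' z.
Proof. by rewrite /pairing mulmxDl mxE. Qed.

Lemma pairingZl k u z : pairing (k *: u) z = k * pairing u z.
Proof. by rewrite /pairing -scalemxAl mxE. Qed.

Lemma pairingNl u z : pairing (- u) z = - pairing u z.
Proof. by rewrite -scaleN1r pairingZl mulN1r. Qed.

Lemma pairingBl u u' z : pairing (u - u') z = pairing u z - pairing u' z.
Proof. by rewrite pairingDl pairingNl. Qed.

Lemma pairingDr u z z' : pairing u (z + z') = pairing u z + pairing u z'.
Proof. by rewrite /pairing mulmxDr mxE. Qed.

Lemma pairingZr k u z : pairing u (k *: z) = k * pairing u z.
Proof. by rewrite /pairing -scalemxAr mxE. Qed.

Lemma pairing_suml (I : finType) (f : I -> 'rV[F]_n) z :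
  pairing (\sum_i f i) z = \sum_i pairing (f i) z.
Proof. by rewrite /pairing mulmx_suml summxE. Qed.

(** Induction on the number of forms. If g is not already nonnegatively generated
    by the first m forms, some z0 satisfies all of them and violates g, hence
    violates the last form a. Normalizing z0 to x with a(x) = 1, the projection
    along x onto the hyperplane a = 0 turns every form u into u - u(x) a; the
    hypothesis passes to these projected forms, and the coefficient of a is
    recovered from the value of g at x. *)
Lemma farkas m (v : 'I_m -> 'rV[F]_n) g :
  (forall z, (forall i, pairing (v i) z <= 0) -> pairing g z <= 0) ->
  exists2 l : 'I_m -> F, forall i, 0 <= l i & g = \sum_i l i *: v i.
Proof.
elim: m v g => [|m IHm] v g hg.
  exists (fun=> 0) => //; rewrite big_ord0; apply/rowP => j.
  have h z : pairing g z <= 0 by apply: hg => -[].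
  have := h (- delta_mx j 0); have := h (delta_mx j 0).
  rewrite /pairing mulmxN -colE !mxE; lra.
pose w i := v (lift ord_max i).
case: (pselect (forall z, (forall i, pairing (w i) z <= 0) -> pairing g z <= 0)).
  move=> /IHm [l l0 ->].
  exists (fun i => if unlift ord_max i is Some j then l j else 0).
    by move=> i; case: unliftP.
  rewrite big_ord_recr /= unlift_none scale0r addr0; apply: eq_bigr => i _.
  have -> : widen_ord (leqnSn m) i = lift ord_max i.
    by apply/val_inj; rewrite /= /bump leqNgt ltn_ord.
  by rewrite liftK.
move=> /existsNP [z0 /not_implyP [hz0 /negP]]; rewrite -ltNge => gz0.
set a := v ord_max.
have az0 : 0 < pairing a z0.
  rewrite ltNge; apply/negP => az0; move: gz0; rewrite ltNge hg // => i.
  by case: (unliftP ord_max i) => [j ->|->]; [exact: hz0|].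
pose x := (pairing a z0)^-1 *: z0.
have ax : pairing a x = 1 by rewrite pairingZr mulVf ?gt_eqF.
have gx : 0 < pairing g x by rewrite pairingZr mulr_gt0 ?invr_gt0.
have wx i : pairing (w i) x <= 0 by rewrite pairingZr pmulr_rle0 ?invr_gt0.
have [|l l0 hl] := IHm (fun i => w i - pairing (w i) x *: a)
                       (g - pairing g x *: a).
  move=> z hz; have := hg (z - pairing a z *: x).
  have E u : pairing u (z - pairing a z *: x) = pairing (u - pairing u x *: a) z.
    by rewrite -scaleNr pairingDr pairingBl pairingZr pairingZl mulNr mulrC.
  rewrite !E; apply => i; rewrite E.
  case: (unliftP ord_max i) => [j ->|->]; first exact: hz.
  by rewrite -/a ax scale1r subrr /pairing mul0mx mxE.
exists (fun i => if unlift ord_max i is Some j then l j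
                 else pairing g x - \sum_j l j * pairing (w j) x).
  move=> i; case: unliftP => // _; rewrite subr_ge0.
  by apply: le_trans (ltW gx); apply: sumr_le0 => j _; rewrite mulr_ge0_le0.
rewrite big_ord_recr /= unlift_none.
rewrite -[LHS](subrK (pairing g x *: a)) hl scalerBl scaler_suml.
rewrite addrA addrAC; congr (_ + _); rewrite -sumrB; apply: eq_bigr => i _.
have -> : widen_ord (leqnSn m) i = lift ord_max i.
  by apply/val_inj; rewrite /= /bump leqNgt ltn_ord.
by rewrite liftK scalerBr scalerA.
Qed.

(** For each index i0, [farkas] yields a nonnegative relation among the v i whose
    coefficient at i0 is positive; the sum of these relations is positive
    everywhere. Over rat this produces integral weights, over a realType it
    makes exponential sums coercive. *)
Lemma stiemke m (v : 'I_m -> 'rV[F]_n) :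
  (exists2 l : 'I_m -> F, forall i, 0 < l i & \sum_i l i *: v i = 0) \/
  (exists z i0, (forall i, 0 <= pairing (v i) z) /\ 0 < pairing (v i0) z).
Proof.
case: (pselect (exists z i0, (forall i, 0 <= pairing (v i) z) /\
  0 < pairing (v i0) z)); [by right | move=> noz; left].
have kerv i0 : exists l : 'I_m -> F,
    [/\ forall i, 0 <= l i, 0 < l i0 & \sum_i l i *: v i = 0].
  have [|l l0 hl] := @farkas m v (- v i0).
    move=> z hz; rewrite pairingNl oppr_le0 leNgt; apply/negP => hz0.
    apply: noz; exists (- z), i0; split; last first.
      by rewrite -scaleN1r pairingZr mulN1r oppr_gt0.
    by move=> i; rewrite -scaleN1r pairingZr mulN1r oppr_ge0.
  exists (fun i => l i + (i == i0)%:R); split.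
  - by move=> i; rewrite addr_ge0.
  - by rewrite eqxx ltr_wpDl.
  - under eq_bigr do rewrite scalerDl.
    rewrite big_split /= -hl (bigD1 i0) //= eqxx scale1r big1 ?addr0 ?addNr //.
    by move=> i /negbTE ->; rewrite scale0r.
have [l hl] := choice kerv.
exists (fun i => \sum_k l k i).
  move=> i; rewrite (bigD1 i) //= ltr_pwDl //; first by case: (hl i).
  by apply: sumr_ge0 => k _; case: (hl k).
under eq_bigr do rewrite scaler_suml.
by rewrite exchange_big big1 // => k _; case: (hl k).
Qed.

End Farkas.

(** * Critical points of exponential sums *)

Section ExponentialSums.
Variable R : realType.

Lemma continuous_sumf (T : topologicalType) (I : finType) (f : I -> T -> R) :
  (forall i, continuous (f i)) -> continuous (fun x => \sum_i f i x).
Proof.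
move=> cf x; rewrite /index_enum; elim: (Finite.enum I) => [|i s IHs].
  under [X in continuous_at _ X]eq_fun do rewrite big_nil.
  exact: cvg_cst.
under [X in continuous_at _ X]eq_fun do rewrite big_cons.
by apply: cvgD; [exact: cf | exact: IHs].
Qed.

Lemma continuous_mulf (T : topologicalType) (f g : T -> R) :
  continuous f -> continuous g -> continuous (fun x => f x * g x).
Proof. by move=> cf cg x; exact: cvgM (cf x) (cg x). Qed.

Lemma continuous_compf (T : topologicalType) (f : T -> R) (g : R -> R) :
  continuous f -> continuous g -> continuous (fun x => g (f x)).
Proof. by move=> cf cg x; exact: continuous_comp (cf x) (cg _). Qed.

Lemma ge0_of_perturbation (a k : R) :
  (forall t, 0 < t -> t <= 1 -> 0 <= a + t * k) -> 0 <= a.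
Proof.
move=> h; rewrite leNgt; apply/negP => a0.
have k0 : 0 < k.
  by have := h 1 ltr01 (lexx _); rewrite mul1r; lra.
have m0 : 0 < Num.min 1 (- a / (2 * k)).
  by rewrite lt_min ltr01 divr_gt0 ?oppr_gt0 ?mulr_gt0.
have := h _ m0; rewrite ge_min lexx /= => /(_ isT).
have : Num.min 1 (- a / (2 * k)) * k <= - a / (2 * k) * k.
  by rewrite ler_pM2r // ge_min lexx orbT.
have -> : - a / (2 * k) * k = - a / 2 by field; rewrite gt_eqF.
lra.
Qed.

(** First-order condition at a minimum: the function of t on the right is
    minimal at t = 0 and the conclusion bounds its derivative there. The
    elementary estimate exp u - 1 <= u + u^2 exp |u| replaces differentiation. *)
Lemma exp_first_order (I : finType) (w q : I -> R) :
  (forall i, 0 <= w i) ->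
  (forall t, \sum_i w i <= \sum_i w i * expR (t * q i)) ->
  0 <= \sum_i w i * q i.
Proof.
move=> w0 h.
apply: (@ge0_of_perturbation _ (\sum_i w i * (q i ^+ 2 * expR `|q i|))).
move=> t t0 t1; rewrite -(pmulr_rge0 _ t0).
have {h} := h t; rewrite -subr_ge0 -sumrB.
move=> /le_trans; apply; rewrite mulr_sumr -big_split mulr_sumr /=.
apply: ler_sum => i _.
have -> : w i * expR (t * q i) - w i = w i * (expR (t * q i) - 1) by ring.
have -> : t * (w i * q i + t * (w i * (q i ^+ 2 * expR `|q i|))) =
  w i * (t * q i + (t * q i) ^+ 2 * expR `|q i|) by ring.
apply: ler_wpM2l => //.
set u := t * q i.
have eu : expR u <= expR `|q i|.
  rewrite ler_expR /u; apply: le_trans (ler_norm _) _.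
  by rewrite normrM gtr0_norm // ler_piMl.
have E0 : 1 <= expR `|q i| by rewrite -expR0 ler_expR.
have h1 : expR u - 1 <= u * expR u.
  have := expR_ge1Dx (- u); rewrite expRN => h1.
  have := ler_wpM2r (expR_ge0 u) h1; rewrite mulVf ?gt_eqF ?expR_gt0 //; lra.
have [u0|u0] := leP 0 u.
  have : u * expR u <= u * (1 + u * expR u) by apply: ler_wpM2l => //; lra.
  have : u ^+ 2 * expR u <= u ^+ 2 * expR `|q i| by apply: ler_wpM2l; rewrite ?sqr_ge0.
  nra.
have := expR_ge1Dx u.
have := sqr_ge0 u; nra.
Qed.

(** The function t |-> sum_i c_i exp((t N)_i) attains its minimum. On a sublevel
    set every (t N)_i is bounded above; the positive relation l bounds it below
    as well; and since N has independent rows, t is then bounded. The minimum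
    over a large box is therefore global, and the gradient vanishes there. *)
Lemma exp_critical_point r m (N : 'M[R]_(r, m)) (c l : 'I_m -> R) :
  row_free N -> (forall i, 0 < c i) -> (forall i, 0 < l i) ->
  (forall j, \sum_i l i * N j i = 0) ->
  exists t : 'rV_r,
    forall j, \sum_i c i * expR ((t *m N) 0 i) * N j i = 0.
Proof.
move=> Nfree c0 l0 lN.
pose f (t : 'rV[R]_r) := \sum_i c i * expR ((t *m N) 0 i).
have cN i : continuous (fun t : 'rV[R]_r => (t *m N) 0 i).
  under eq_fun do rewrite mxE.
  apply: continuous_sumf => j; apply: continuous_mulf; last exact: cst_continuous.
  by move=> t; exact: coord_continuous.
have cf : continuous f.
  apply: continuous_sumf => i; apply: continuous_mulf; first exact: cst_continuous.
  apply: (continuous_compf (cN i)); exact: continuous_expR.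
pose S := f 0.
have S0 : 0 <= S by apply: sumr_ge0 => i _; rewrite mulr_ge0 ?expR_ge0 // ltW.
pose M := \sum_i S / c i.
have M0 : 0 <= M by apply: sumr_ge0 => i _; rewrite divr_ge0 // ltW.
(* Upper bound on the exponents over the sublevel set of f 0. *)
have sub1 t i : f t <= S -> (t *m N) 0 i <= M.
  move=> ft; have h1 : c i * expR ((t *m N) 0 i) <= S.
    apply: le_trans ft; rewrite /f (bigD1 i) //= lerDl.
    by apply: sumr_ge0 => k _; rewrite mulr_ge0 ?expR_ge0 // ltW.
  have h2 : expR ((t *m N) 0 i) <= S / c i by rewrite ler_pdivlMr // mulrC.
  have : S / c i <= M.
    rewrite /M (bigD1 i) //= lerDl; apply: sumr_ge0 => k _.
    by rewrite divr_ge0 // ltW.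
  have := expR_ge1Dx ((t *m N) 0 i); lra.
have lsum t : \sum_i l i * (t *m N) 0 i = 0.
  under eq_bigr do rewrite mxE mulr_sumr.
  rewrite exchange_big /= big1 // => j _.
  under eq_bigr do rewrite mulrCA.
  by rewrite -mulr_sumr lN mulr0.
pose L := \sum_i l i.
pose M' := \sum_i M * (L / l i) + M.
have L0 : 0 <= L by apply: sumr_ge0 => i _; rewrite ltW.
(* The relation l turns the upper bounds into two-sided ones. *)
have sub2 t i : f t <= S -> `|(t *m N) 0 i| <= M'.
  move=> ft; have h1 := sub1 t i ft.
  have P0 : 0 <= \sum_i M * (L / l i).
    by apply: sumr_ge0 => k _; rewrite mulr_ge0 // divr_ge0 // ltW.
  rewrite ler_norml; apply/andP; split; last by rewrite /M'; lra.
  have h2 : \sum_k l k * (M - (t *m N) 0 k) = M * L.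
    under eq_bigr do rewrite mulrBr.
    by rewrite sumrB lsum subr0 -mulr_suml mulrC.
  have h3 : l i * (M - (t *m N) 0 i) <= M * L.
    rewrite -h2 (bigD1 i) //= lerDl; apply: sumr_ge0 => k _.
    by rewrite mulr_ge0 ?subr_ge0 ?sub1 // ltW.
  have h4 : M - (t *m N) 0 i <= M * (L / l i).
    by rewrite mulrA ler_pdivlMr // mulrC.
  have : M * (L / l i) <= \sum_i M * (L / l i).
    rewrite (bigD1 i) //= lerDl; apply: sumr_ge0 => k _.
    by rewrite mulr_ge0 // divr_ge0 // ltW.
  by rewrite /M'; lra.
have M'0 : 0 <= M'.
  rewrite /M' addr_ge0 //; apply: sumr_ge0 => k _.
  by rewrite mulr_ge0 // divr_ge0 // ltW.
pose P := pinvmx N.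
pose Bd := \sum_j \sum_i M' * `|P i j|.
have Bd0 : 0 <= Bd.
  by apply: sumr_ge0 => j _; apply: sumr_ge0 => i _; rewrite mulr_ge0.
(* A right inverse of N recovers t from its exponents. *)
have sub3 t j : f t <= S -> `|t 0 j| <= Bd.
  move=> ft; have -> : t = t *m N *m P by rewrite -mulmxA mulmxVp // mulmx1.
  rewrite [(t *m N *m P) 0 j]mxE; apply: le_trans (ler_norm_sum _ _ _) _.
  rewrite /Bd (bigD1 j) //= ler_wpDr //.
    by apply: sumr_ge0 => k _; apply: sumr_ge0 => i _; rewrite mulr_ge0.
  by apply: ler_sum => i _; rewrite normrM ler_wpM2r // sub2.
pose A : set 'rV[R]_r := [set v | forall j, `[- Bd, Bd]%classic (v ord0 j)]%classic.
have cA : compact A by apply: (@rV_compact R r (fun=> `[- Bd, Bd]%classic)) => j;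
  exact: segment_compact.
have A0 : A 0 by move=> j /=; rewrite in_itv /= mxE oppr_le0 Bd0.
have [t tA tmin] : exists2 t, t \in A & forall u, u \in A -> f t <= f u.
  apply: compact_EVT_min => //; first by exists (0 : 'rV[R]_r); exact: A0.
  exact: continuous_subspaceT.
have gmin u : f t <= f u.
  have [fu|fu] := leP (f u) S; last first.
    by apply: le_trans (ltW fu); apply: tmin; rewrite inE.
  apply: tmin; rewrite inE => j /=; rewrite in_itv /= -ler_norml.
  exact: sub3.
exists t => j.
have main (e : R) : 0 <= \sum_i c i * expR ((t *m N) 0 i) * (e * N j i).
  apply: exp_first_order; first by move=> i; rewrite mulr_ge0 ?expR_ge0 // ltW.
  move=> s; have := gmin (t + (s * e) *: delta_mx 0 j); rewrite /f.
  move=> /le_trans; apply; apply: ler_sum => i _.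
  rewrite mulmxDl mxE -scalemxAl -rowE !mxE expRD mulrA.
  by rewrite [s * (e * _)]mulrA.
have := main 1; have := main (-1).
under eq_bigr do rewrite mulN1r mulrN.
under [X in _ -> 0 <= X -> _]eq_bigr do rewrite mul1r.
rewrite sumrN; lra.
Qed.

End ExponentialSums.

(** * Tight points *)

Section TightPoint.
Variable R : realType.

(** Moving y to y - t z with t -> +oo makes the term i0 vanish and increases no
    other term, so the lower bound survives without that term. *)
Lemma expR_sum_drop n m (v : 'I_m.+1 -> 'rV[R]_n) (c : 'I_m.+1 -> R) (d : R)
    (z : 'cV_n) (i0 : 'I_m.+1) :
  (forall i, 0 <= c i) ->
  (forall y, d <= \sum_i c i * expR (pairing (v i) y)) ->
  (forall i, 0 <= pairing (v i) z) -> 0 < pairing (v i0) z ->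
  forall y, d <= \sum_i c (lift i0 i) * expR (pairing (v (lift i0 i)) y).
Proof.
move=> c0 hd z0 zi0 y; set S := \sum_i _; rewrite leNgt; apply/negP => Sd.
set T := c i0 * expR (pairing (v i0) y).
have T0 : 0 <= T by rewrite mulr_ge0 ?expR_ge0.
pose t := T / ((d - S) * pairing (v i0) z).
have t0 : 0 <= t by rewrite divr_ge0 // mulr_ge0 ?ltW // subr_gt0.
have : d - S <= T / (1 + t * pairing (v i0) z).
  have := hd (y + (- t) *: z); rewrite (bigD1_ord i0) //= => h.
  have hS : \sum_(i < m) c (lift i0 i) *
      expR (pairing (v (lift i0 i)) (y + - t *: z)) <= S.
    apply: ler_sum => i _; apply: ler_wpM2l => //; rewrite ler_expR.
    by rewrite pairingDr pairingZr gerDl mulNr oppr_le0 mulr_ge0.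
  (* As exp (- u) <= 1 / (1 + u); t makes the right-hand side less than d - S. *)
  have hT : c i0 * expR (pairing (v i0) (y + - t *: z)) <=
      T / (1 + t * pairing (v i0) z).
    rewrite pairingDr expRD mulrA ler_wpM2l // pairingZr mulNr expRN.
    by rewrite lef_pV2 ?posrE ?expR_gt0 ?expR_ge1Dx // ltr_wpDr // mulr_ge0 // ltW.
  lra.
have -> : t * pairing (v i0) z = T / (d - S).
  by rewrite /t; field; rewrite !gt_eqF // subr_gt0.
have dS : 0 < d - S by rewrite subr_gt0.
rewrite ler_pdivlMr; last by rewrite ltr_wpDr // divr_ge0 // ltW.
by rewrite mulrDr mulr1 mulrCA divff ?gt_eqF // mulr1; lra.
Qed.

(** If the infimum of the exponential sum is attained at y, the terms
    w i = c i exp(v_i y) are the required weights: they satisfy sum_i w_i v_i = 0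
    by criticality and add up to at least d. The infimum may instead escape to
    infinity, in a direction z given by [stiemke]; then one term can be dropped
    by [expR_sum_drop], and the induction proceeds on the number of terms. This
    is why w is only bounded by the terms, with zeros where terms were lost. *)
Lemma exp_tight_point n m (v : 'I_m -> 'rV[R]_n) (c : 'I_m -> R) (d : R) :
  (forall i, 0 <= c i) ->
  (forall y, d <= \sum_i c i * expR (pairing (v i) y)) ->
  exists (y : 'cV_n) (w : 'I_m -> R),
    [/\ forall i, 0 <= w i, forall i, w i <= c i * expR (pairing (v i) y),
        \sum_i w i *: v i = 0 & d <= \sum_i w i].
Proof.
elim: m v c => [|m IHm] v c c0 hd.
  exists 0, (fun=> 0); split => //; try by case.
    by rewrite big_ord0.
  by have := hd 0; rewrite !big_ord0.
have drop i0 : (forall y,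
    d <= \sum_i c (lift i0 i) * expR (pairing (v (lift i0 i)) y)) ->
  exists (y : 'cV_n) (w : 'I_m.+1 -> R),
    [/\ forall i, 0 <= w i, forall i, w i <= c i * expR (pairing (v i) y),
        \sum_i w i *: v i = 0 & d <= \sum_i w i].
  move=> /IHm [//|y [w [w0 wc wv wd]]].
  exists y, (fun i => if unlift i0 i is Some j then w j else 0); split.
  - by move=> i; case: unliftP.
  - move=> i; case: unliftP => [j ->|_]; first exact: wc.
    by rewrite mulr_ge0 ?expR_ge0.
  - rewrite (bigD1_ord i0) //= unlift_none scale0r add0r -[RHS]wv.
    by apply: eq_bigr => i _; rewrite liftK.
  - rewrite (bigD1_ord i0) //= unlift_none add0r; apply: le_trans wd _.
    by apply: ler_sum => i _; rewrite liftK.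
case: (pselect (exists i0, c i0 = 0)) => [[i0 ci0]|nc].
  apply: (drop i0) => y; apply: le_trans (hd y) _.
  by rewrite (bigD1_ord i0) //= ci0 mul0r add0r.
have {nc}cpos i : 0 < c i.
  by rewrite lt_neqAle c0 andbT eq_sym; apply/eqP => ci; apply: nc; exists i.
case: (stiemke v) => [[l lpos lv]|[z [i0 [z0 zi0]]]]; last first.
  exact/(drop i0)/(expR_sum_drop c0 hd z0 zi0).
(* The sum depends on y only through the row space N of V^T, in which the
   parametrization is injective. *)
pose V : 'M[R]_(m.+1, n) := \matrix_i v i.
pose N := row_base V^T.
have /submxP[Y hY] : (V^T <= N)%MS by rewrite eq_row_base.
have /submxP[Z hZ] : (N <= V^T)%MS by rewrite eq_row_base.
have VE i k : V^T k i = v i 0 k by rewrite !mxE.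
have [j|t tcrit] := @exp_critical_point R _ _ N c l (row_base_free _) cpos lpos.
  rewrite hZ; under eq_bigr do rewrite mxE mulr_sumr.
  rewrite exchange_big /= big1 // => k _.
  under eq_bigr do rewrite mulrCA VE.
  rewrite -mulr_sumr (_ : \sum_i _ = 0) ?mulr0 //.
  have h : (\sum_i l i *: v i) 0 k = 0 by rewrite lv mxE.
  by rewrite -[RHS]h summxE; apply: eq_bigr => i _; rewrite mxE.
pose y := (t *m Z)^T.
have yE i : pairing (v i) y = (t *m N) 0 i.
  rewrite /pairing hZ mulmxA !mxE; apply: eq_bigr => k _.
  by rewrite VE [y k 0]mxE mulrC.
exists y, (fun i => c i * expR (pairing (v i) y)); split => //.
  by move=> i; rewrite mulr_ge0 ?expR_ge0.
apply/rowP => k; rewrite summxE mxE.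
under eq_bigr do rewrite mxE -VE hY mxE mulr_sumr.
rewrite exchange_big /= big1 // => j _.
under eq_bigr do rewrite mulrCA yE.
by rewrite -mulr_sumr tcrit mulr0.
Qed.

End TightPoint.

(** * Integral weights on simplices *)

Section SimplicialWeights.
Variables (n : nat) (I : finType) (e : I -> 'X_{1..n}) (b : 'X_{1..n}).

(** An identity between exponents, without division, so that it can be read both in
    a real vector space and in the exponents of monomials. *)
Definition barycentric (l : I -> nat) :=
  (\sum_i e i *+ l i = b *+ \sum_i l i)%MM.

Definition affind_on (R : realType) (T : {set I}) :=
  forall w : I -> R, (forall i, i \notin T -> w i = 0) -> \sum_i w i = 0 ->
    \sum_i w i *: expt_pt R (e i) = 0 -> forall i, w i = 0.

Lemma clear_denominators (J : finType) (l : J -> rat) :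
  (forall j, 0 < l j) ->
  exists2 k : J -> nat, forall j, (0 < k j)%N &
    exists2 D : nat, (0 < D)%N & forall j, (k j)%:R = D%:R * l j.
Proof.
move=> l0; exists (fun j => `|numq (l j)| * \prod_(i | i != j) `|denq (l i)|)%N.
  move=> j; rewrite muln_gt0 absz_gt0 numq_eq0 gt_eqF //=.
  by rewrite prodn_gt0 // => i; rewrite absz_gt0 denq_neq0.
exists (\prod_i `|denq (l i)|)%N => [|j].
  by rewrite prodn_gt0 // => i; rewrite absz_gt0 denq_neq0.
rewrite [in RHS](bigD1 j) //= !natrM [RHS]mulrAC; congr (_ * _).
rewrite !natr_absz !gtr0_norm ?denq_gt0 ?numq_gt0 //.
by rewrite numqE mulrC.
Qed.

Lemma barycentric_real (R : realType) (l : I -> nat) : barycentric l ->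
  \sum_i (l i)%:R *: (expt_pt R (e i) - expt_pt R b) = 0.
Proof.
move=> hl; apply/rowP => j; rewrite summxE mxE.
under eq_bigr do rewrite !mxE mulrBr -!natrM.
rewrite sumrB -!natr_sum -big_distrl /=.
have /mnmP/(_ j) := hl; rewrite mnm_sumE mulmnE.
under eq_bigr do rewrite mulmnE.
by rewrite mulnC => <-; under eq_bigr do rewrite mulnC; rewrite subrr.
Qed.

(** The points being integral, [stiemke] over the rationals applies to the vectors
    e i - b for i in T. Its second alternative would contradict the positive real
    relation w, so there is a positive rational relation; denominators are
    cleared. *)
Lemma integral_weights (R : realType) (T : {set I}) (w : I -> R) :
  (forall i, i \in T -> 0 < w i) -> (forall i, i \notin T -> w i = 0) ->
  \sum_i w i *: (expt_pt R (e i) - expt_pt R b) = 0 ->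
  exists2 l : I -> nat, forall i, (0 < l i)%N = (i \in T) & barycentric l.
Proof.
move=> w0 wT wker.
pose v (k : 'I_#|T|) : 'rV[rat]_n :=
  \row_j ((e (enum_val k) j)%:R - (b j)%:R).
case: (stiemke v) => [[l l0 lv]|[z [k0 [z0 zk0]]]]; last first.
  exfalso; pose zR : 'cV[R]_n := map_mx ratr z.
  have E k : pairing (expt_pt R (e (enum_val k)) - expt_pt R b) zR =
             ratr (pairing (v k) z).
    rewrite /pairing !mxE rmorph_sum; apply: eq_bigr => j _.
    by rewrite !mxE rmorphM rmorphB !rmorph_nat.
  have : pairing (\sum_i w i *: (expt_pt R (e i) - expt_pt R b)) zR = 0.
    by rewrite wker /pairing mul0mx mxE.
  rewrite pairing_suml (bigD1 (enum_val k0)) //= pairingZl E.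
  apply/eqP; rewrite gt_eqF //; apply: ltr_pwDl.
    by rewrite mulr_gt0 ?ltr0q ?w0 ?enum_valP.
  apply: sumr_ge0 => i _; rewrite pairingZl.
  have [iT|/wT->] := boolP (i \in T); last by rewrite mul0r.
  by rewrite -(enum_rankK_in iT iT) E mulr_ge0 ?ler0q // ltW ?w0 ?enum_valP.
have [k k0 [D D0 kD]] := clear_denominators l0.
pose l' i := (\sum_(x | enum_val x == i) k x)%N.
have sumE (F : I -> nat) : (\sum_i l' i * F i = \sum_x k x * F (enum_val x))%N.
  under eq_bigr do rewrite big_distrl /=.
  rewrite (exchange_big_dep predT) //=; apply: eq_bigr => x _.
  by rewrite (big_pred1 (enum_val x)) // => i /=; rewrite eq_sym.
exists l' => [i|].
  apply/idP/idP => [|iT]; last first.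
    rewrite /l' (bigD1 (enum_rank_in iT i)) /= ?enum_rankK_in //.
    by rewrite addn_gt0 k0.
  by apply: contraTT => iT; rewrite -eqn0Ngt /l' big_pred0 // => x;
    apply: contraNF iT => /eqP <-; exact: enum_valP.
apply/mnmP => j; rewrite mnm_sumE mulmnE.
under eq_bigr do rewrite mulmnE mulnC.
have -> : (\sum_i l' i = \sum_i l' i * 1)%N by apply: eq_bigr => i _; rewrite muln1.
rewrite !sumE; under [in RHS]eq_bigr do rewrite muln1.
apply/eqP; rewrite -(@eqr_nat rat) natrM !natr_sum mulr_sumr -subr_eq0 -sumrB.
apply/eqP; transitivity (D%:R * (\sum_i l i *: v i) 0 j).
  rewrite summxE mulr_sumr; apply: eq_bigr => x _.
  by rewrite natrM kD !mxE; ring.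
by rewrite lv mxE mulr0.
Qed.

Section Decomposition.
Variable R : realType.
Implicit Types (w x : I -> R) (T : {set I}) (l : I -> nat).

Let ker w := \sum_i w i *: (expt_pt R (e i) - expt_pt R b) = 0.

Lemma kerE w : ker w ->
  \sum_i w i *: expt_pt R (e i) = (\sum_i w i) *: expt_pt R b.
Proof.
rewrite /ker; under eq_bigr do rewrite scalerBr.
by rewrite sumrB scaler_suml => /subr0_eq.
Qed.

(** Over an affinely independent family, barycentric coordinates of b are unique
    up to a scalar. *)
Lemma simplicial_weights_unique T w l :
  affind_on R T -> (forall i, i \notin T -> w i = 0) -> ker w ->
  (forall i, (0 < l i)%N = (i \in T)) -> barycentric l ->
  (0 < \sum_i l i)%N ->
  forall i, w i = (\sum_i w i) / (\sum_i l i)%:R * (l i)%:R.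
Proof.
move=> Tind wT wker lT lbary l0 i.
have lker := barycentric_real R lbary.
have L0 : (\sum_i l i)%:R != 0 :> R by rewrite pnatr_eq0 -lt0n.
pose x j := (\sum_i l i)%:R * w j - (\sum_i w i) * (l j)%:R.
have : x i = 0.
  apply: (Tind x) => [j jT||].
  - rewrite /x wT // mulr0; have := lT j; rewrite (negbTE jT) lt0n => /negbFE/eqP ->.
    by rewrite mulr0 subrr.
  - by rewrite sumrB -!mulr_sumr -natr_sum mulrC subrr.
  - under eq_bigr do rewrite scalerBl -!scalerA.
    rewrite sumrB -!scaler_sumr kerE // (@kerE (fun i => (l i)%:R)) //.
    by rewrite !scalerA -natr_sum mulrC subrr.
by rewrite /x => /subr0_eq h; rewrite mulrAC -h mulrAC divff // mul1r.
Qed.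

(** t is the first time at which w + t x meets the boundary of the orthant. *)
Lemma shrink_support w x i0 :
  (forall i, 0 <= w i) -> (forall i, w i = 0 -> x i = 0) -> x i0 < 0 ->
  exists2 t, 0 < t &
    (forall i, 0 <= w i + t * x i) /\ exists2 i, w i != 0 & w i + t * x i = 0.
Proof.
move=> w0 xw xi0.
have wpos i : x i < 0 -> 0 < w i.
  move=> xi; rewrite lt_neqAle w0 andbT eq_sym.
  by apply: contraTneq xi => /xw ->; rewrite ltxx.
case: (@Order.TotalTheory.arg_minP _ _ _ i0 (fun i => x i < 0)
  (fun i => w i / - x i) xi0).
move=> i1 xi1 imin; exists (w i1 / - x i1).
  by rewrite divr_gt0 ?oppr_gt0 ?wpos.
split=> [i|]; last first.
  exists i1; first by rewrite gt_eqF ?wpos.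
  by field; rewrite lt_eqF.
have [xi|xi] := ltP (x i) 0; last first.
  by rewrite addr_ge0 // mulr_ge0 // divr_ge0 // oppr_ge0 ltW.
have := imin i xi; rewrite ler_pdivlMr ?oppr_gt0 //; lra.
Qed.

(** Conic Caratheodory theorem with generators that do not depend on w: each set T
    carries one fixed integral vector l T, which is zero unless T is the support
    of barycentric weights on an affinely independent family. If the support of
    w is affinely dependent, an affine relation x moves w in the two directions x
    and - x until its support shrinks, and w is a convex combination of the two
    endpoints; otherwise w is a multiple of the generator of its support. *)
Lemma simplicial_decomposition : exists2 l : {set I} -> I -> nat,
  (forall T, barycentric (l T) /\
     ((0 < \sum_i l T i)%N ->
      affind_on R T /\ forall i, (0 < l T i)%N = (i \in T))) &
  forall w, (forall i, 0 <= w i) -> ker w ->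
    exists2 k : {set I} -> R, forall T, 0 <= k T &
      forall i, w i = \sum_T k T * (l T i)%:R.
Proof.
pose good T l := [/\ barycentric l, affind_on R T &
  forall i, (0 < l i)%N = (i \in T)].
have /choice [l lP] : forall T, exists l,
    good T l \/ (~ (exists l, good T l) /\ forall i, l i = 0%N).
  move=> T; case: (pselect (exists l, good T l)) => [[l hl]|h].
    by exists l; left.
  by exists (fun=> 0%N); right.
exists l => [T|].
  case: (lP T) => [[h1 h2 h3]|[_ h]]; first by split.
  split; last by rewrite big1 // => i _; rewrite h.
  apply/mnmP => j; rewrite mnm_sumE mulmnE !big1 ?muln0 // => i _.
  by rewrite h mulmnE muln0.
move=> w; have [m] := ubnP #|[set i | w i != 0]|.
elim: m w => // m IHm w; rewrite ltnS => wm w0 wker.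
pose Z := [set i | w i != 0]; have ZE i : (i \in Z) = (w i != 0) by rewrite inE.
have supp i : i \notin Z -> w i = 0.
  by rewrite ZE negbK => /eqP.
case: (pselect (affind_on R Z)) => [ind|].
  have [l0 l0T l0b] : exists2 l, forall i, (0 < l i)%N = (i \in Z)
      & barycentric l.
    apply: (integral_weights (w := w)) => // i.
    by rewrite ZE lt_neqAle w0 andbT eq_sym.
  case: (lP Z) => [[h1 h2 h3]|[[]]]; last by exists l0.
  have [wz|[i1 wi1]] : (forall i, w i = 0) \/ exists i, w i != 0.
    case: (pselect (exists i, w i != 0)) => [|h]; [by right|left => i].
    by apply/eqP/negPn/negP => wi; apply: h; exists i.
    exists (fun=> 0) => // i; rewrite wz; symmetry; apply: big1 => T _.
    exact: mul0r.
  have L0 : (0 < \sum_i l Z i)%N.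
    by rewrite (bigD1 i1) //= addn_gt0 h3 ZE wi1.
  exists (fun T => if T == Z then
     (\sum_i w i) / (\sum_i l Z i)%:R else 0) => [T|i].
    by case: eqP => // _; rewrite divr_ge0 //; apply: sumr_ge0.
  rewrite (bigD1 Z) //= eqxx [X in _ + X]big1 ?addr0.
    exact: (simplicial_weights_unique (T := Z)).
  by move=> T /negbTE ->; rewrite mul0r.
move=> /existsNP [x] /not_implyP [xT] /not_implyP [x0] /not_implyP [xpt].
move=> /existsNP [i1 xi1].
have xw i : w i = 0 -> x i = 0 by move=> wi; apply: xT; rewrite ZE wi eqxx.
have xker : ker x.
  rewrite /ker; under eq_bigr do rewrite scalerBr.
  by rewrite sumrB -scaler_suml x0 scale0r subr0.
have step y i : (forall i, w i = 0 -> y i = 0) -> ker y -> y i < 0 ->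
    exists2 t, 0 < t & exists2 k : {set I} -> R, forall T, 0 <= k T &
      forall i, w i + t * y i = \sum_T k T * (l T i)%:R.
  move=> yw yker /(shrink_support w0 yw) [t t0 [tw [i2 wi2 ti2]]].
  exists t => //; apply: IHm => //.
    suff /proper_card h : [set i | w i + t * y i != 0] \proper Z.
      exact: leq_trans h wm.
    apply/properP; split; last by exists i2; rewrite inE // ti2 eqxx.
    apply/fintype.subsetP => j; rewrite !inE; apply: contra_neq => wj.
    by rewrite wj yw // mulr0 addr0.
  rewrite /ker; under eq_bigr do rewrite scalerDl -scalerA.
  by rewrite big_split /= wker -scaler_sumr yker scaler0 addr0.
have [i2 xi2] : exists i, x i < 0.
  apply: contrapT => /forallNP h; apply: xi1.
  have {}h i : 0 <= x i by rewrite leNgt; apply/negP.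
  have /eqP := x0; rewrite psumr_eq0 // => /allP /(_ i1).
  by rewrite mem_index_enum => /(_ isT) /eqP.
have [i3 xi3] : exists i, - x i < 0.
  apply: contrapT => /forallNP h; apply: xi1.
  have {}h i : 0 <= - x i by rewrite leNgt; apply/negP.
  have /eqP : \sum_i - x i = 0 by rewrite sumrN x0 oppr0.
  rewrite psumr_eq0 // => /allP /(_ i1).
  by rewrite mem_index_enum oppr_eq0 => /(_ isT) /eqP.
have [t1 t10 [k1 k10 k1P]] := step x i2 xw xker xi2.
have [| |t2 t20 [k2 k20 k2P]] := step (fun i => - x i) i3 _ _ xi3.
- by move=> i /xw ->; rewrite oppr0.
- rewrite /ker; under eq_bigr do rewrite scaleNr.
  by rewrite sumrN xker oppr0.
exists (fun T => (t2 * k1 T + t1 * k2 T) / (t1 + t2)) => [T|i].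
  by rewrite divr_ge0 // addr_ge0 // ?mulr_ge0 // ltW.
transitivity ((t2 * (w i + t1 * x i) + t1 * (w i + t2 * - x i)) / (t1 + t2)).
  by field; rewrite gt_eqF // addr_gt0.
rewrite k1P k2P !mulr_sumr -big_split mulr_suml /=.
by apply: eq_bigr => T _; ring.
Qed.

End Decomposition.
End SimplicialWeights.

(** * Sums of binomial squares *)

Section BinomialSquares.
Variables (R : realType) (n : nat).
Implicit Types (f g : {mpoly R[n]}) (u v m : 'X_{1..n}) (M : seq 'X_{1..n}).
Implicit Types (X : 'M[R]_2) (h : 'I_n -> R) (K : nat).

Lemma mpoly_linear_ext (V : lmodType R) (F G : {mpoly R[n]} -> V) :
  linear F -> linear G -> (forall m, F 'X_[m] = G 'X_[m]) -> F =1 G.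
Proof.
move=> linF linG FG f.
have F0 : F 0 = 0.
  by have := linF (-1) 0 0; rewrite scaler0 add0r scaleN1r addNr.
have G0 : G 0 = 0.
  by have := linG (-1) 0 0; rewrite scaler0 add0r scaleN1r addNr.
rewrite [f]mpolyE; elim: (msupp f) => [|m s IHs]; first by rewrite !big_nil F0 G0.
by rewrite !big_cons linF linG FG IHs.
Qed.

Lemma quadE X (u : 'rV[R]_2) : (u *m X *m u^T) 0 0 =
  X 0 0 * u 0 0 ^+ 2 + (X 0 1 + X 1 0) * (u 0 0 * u 0 1) + X 1 1 * u 0 1 ^+ 2.
Proof.
rewrite !mxE !big_ord_recl !big_ord0 !mxE !big_ord_recl !big_ord0 /=.
have -> : lift ord0 ord0 = 1 :> 'I_2 by apply/val_inj.
by ring.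
Qed.

Definition sym2 (t w : R) : 'M[R]_2 := \matrix_(i, j) if i == j then t else w.

Lemma sym2_psd t w : `|w| <= t -> psd_cone R 2 (sym2 t w).
Proof.
rewrite ler_norml => /andP[tw wt]; split=> [|u].
  by apply/matrixP => i j; rewrite !mxE eq_sym.
rewrite quadE !mxE /=; set x := u 0 0; set y := u 0 1.
have -> : t * x ^+ 2 + (w + w) * (x * y) + t * y ^+ 2 =
  ((t + w) * (x + y) ^+ 2 + (t - w) * (x - y) ^+ 2) / 2 by field.
by rewrite divr_ge0 // addr_ge0 // mulr_ge0 ?sqr_ge0 //; lra.
Qed.

Lemma psd_diag_ge0 X : psd_cone R 2 X -> 0 <= X 0 0.
Proof.
case=> _ /(_ (\row_j (j == 0)%:R)); rewrite quadE !mxE /=; lra.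
Qed.

Lemma psd_offdiag_le X : psd_cone R 2 X -> X 0 0 = X 1 1 -> `|X 0 1| <= X 0 0.
Proof.
case=> Xsym Xpos X01.
have X10 : X 1 0 = X 0 1 by rewrite -[in LHS]Xsym mxE.
have := Xpos (\row_j 1); have := Xpos (\row_j (if j == 0 then 1 else -1)).
rewrite !quadE !mxE /= X10 -X01 ler_norml => ? ?; apply/andP; split; lra.
Qed.

Lemma psdZ k X : 0 <= k -> psd_cone R 2 X -> psd_cone R 2 (k *: X).
Proof.
move=> k0 [Xsym Xpos]; split=> [|u]; first by rewrite linearZ /= Xsym.
by rewrite -scalemxAr -scalemxAl mxE mulr_ge0.
Qed.

Lemma psdD X Y : psd_cone R 2 X -> psd_cone R 2 Y -> psd_cone R 2 (X + Y).
Proof.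
move=> [Xsym Xpos] [Ysym Ypos]; split=> [|u]; first by rewrite linearD /= Xsym Ysym.
by rewrite mulmxDr mulmxDl mxE addr_ge0.
Qed.

(** The value of the quadratic form X at the pair of monomials with exponents u
    and v. For psd X it is a sum of squares of binomials, and it is linear in X:
    this is how 2 x 2 psd matrices enter the lift. *)
Definition binom X u v : {mpoly R[n]} :=
  X 0 0 *: 'X_[u + u] + (X 0 1 + X 1 0) *: 'X_[u + v] + X 1 1 *: 'X_[v + v].

Lemma binom_linear k X Y u v : binom (k *: X + Y) u v = k *: binom X u v + binom Y u v.
Proof.
by rewrite /binom !mxE -!mul_mpolyC !(mpolyCD, mpolyCM); ring.
Qed.

Lemma binomZ k X u v : binom (k *: X) u v = k *: binom X u v.
Proof. by rewrite /binom !mxE !scalerDr !scalerA mulrDr. Qed.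

Lemma binom0 u v : binom 0 u v = 0.
Proof. by rewrite /binom !mxE addr0 !scale0r !addr0. Qed.

Lemma binom_ge0 X u v h : psd_cone R 2 X -> 0 <= (binom X u v).@[h].
Proof.
move=> [_ Xpos].
have := Xpos (\row_j (if j == 0 then 'X_[u].@[h] else 'X_[v].@[h])).
rewrite quadE !mxE /=.
by rewrite /binom !mevalD !mevalZ !mpolyXD !mevalM !expr2.
Qed.

(** The list M of exponents is part of the notion because a lift can only use
    finitely many pairs of exponents. *)
Inductive sobs M : {mpoly R[n]} -> Prop :=
| sobs0 : sobs M 0
| sobsDbinom f X u v : sobs M f -> psd_cone R 2 X -> u \in M -> v \in M ->
    sobs M (f + binom X u v).

Lemma sobsD M f g : sobs M f -> sobs M g -> sobs M (f + g).
Proof.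
move=> hf; elim=> [|{}g X u v _ IH Xpsd uM vM]; first by rewrite addr0.
by rewrite addrA; exact: sobsDbinom.
Qed.

Lemma sobs_binom M X u v : psd_cone R 2 X -> u \in M -> v \in M ->
  sobs M (binom X u v).
Proof.
move=> Xpsd uM vM; rewrite -[binom _ _ _]add0r.
by apply: sobsDbinom => //; exact: sobs0.
Qed.

Lemma sobsZ M k f : 0 <= k -> sobs M f -> sobs M (k *: f).
Proof.
move=> k0; elim=> [|{}f X u v _ IH Xpsd uM vM]; first by rewrite scaler0; exact: sobs0.
by rewrite scalerDr -binomZ; apply: sobsDbinom => //; exact: psdZ.
Qed.

Lemma sobs_sum M (I : Type) (s : seq I) (P : pred I) (F : I -> {mpoly R[n]}) :
  (forall i, P i -> sobs M (F i)) -> sobs M (\sum_(i <- s | P i) F i).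
Proof. by move=> h; apply: big_ind => //; [exact: sobs0 | exact: sobsD]. Qed.

Lemma sub_sobs M M' f : {subset M <= M'} -> sobs M f -> sobs M' f.
Proof.
move=> MM'; elim=> [|{}f X u v _ IH Xpsd uM vM]; first exact: sobs0.
by apply: sobsDbinom => //; exact: MM'.
Qed.

Lemma sobs_ge0 M f h : sobs M f -> 0 <= f.@[h].
Proof.
elim=> [|{}f X u v _ IH Xpsd _ _]; first by rewrite meval0.
by rewrite mevalD addr_ge0 // binom_ge0.
Qed.

(** All the squares on the same pair of exponents are merged into one matrix, which
    bounds the number of matrices by the square of the size of M. *)
Lemma sobs_gram M f : sobs M f ->
  exists2 X : 'I_(size M) * 'I_(size M) -> 'M[R]_2,
    forall ij, psd_cone R 2 (X ij) &
    f = \sum_ij binom (X ij) (tnth (in_tuple M) ij.1) (tnth (in_tuple M) ij.2).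
Proof.
elim=> [|{}f X u v _ [Y Ypsd ->] Xpsd uM vM].
  exists (fun=> 0); last by rewrite big1 // => ij _; rewrite binom0.
  by move=> _; split=> [|u]; rewrite ?trmx0 // mulmx0 mul0mx mxE.
have /tnthP[i ->] : u \in in_tuple M by [].
have /tnthP[j ->] : v \in in_tuple M by [].
exists (fun ij => (ij == (i, j))%:R *: X + Y ij).
  by move=> ij; apply: psdD => //; exact: psdZ.
under [RHS]eq_bigr do rewrite binom_linear.
rewrite [RHS]big_split /= addrC; congr (_ + _).
rewrite (bigD1 (i, j)) //= eqxx scale1r big1 ?addr0 // => ij /negbTE ->.
by rewrite scale0r.
Qed.

(** The power K serves to clear denominators of exponents, the factors h move the
    tight point to (1, ..., 1). *)
Definition rescale K h f : {mpoly R[n]} :=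
  f \mPo [tuple h i *: 'X_i ^+ K | i < n].

Lemma rescale_linear K h : linear (rescale K h).
Proof. by move=> k f g; rewrite /rescale linearP. Qed.

Lemma rescaleD K h f g : rescale K h (f + g) = rescale K h f + rescale K h g.
Proof. exact: comp_mpolyD. Qed.

Lemma rescaleB K h f g : rescale K h (f - g) = rescale K h f - rescale K h g.
Proof. exact: comp_mpolyB. Qed.

Lemma rescaleZ K h k f : rescale K h (k *: f) = k *: rescale K h f.
Proof. exact: comp_mpolyZ. Qed.

Lemma rescale0 K h : rescale K h 0 = 0.
Proof. exact: comp_mpoly0. Qed.

Lemma rescale_sum K h (I : Type) (s : seq I) (F : I -> {mpoly R[n]}) :
  rescale K h (\sum_(i <- s) F i) = \sum_(i <- s) rescale K h (F i).
Proof. exact: linear_sum. Qed.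

Lemma rescaleX K h m : rescale K h 'X_[m] = 'X_[m].@[h] *: 'X_[m *+ K].
Proof.
rewrite /rescale comp_mpolyX mevalX.
under eq_bigr do rewrite tnth_mktuple exprZn -exprM.
rewrite scaler_prod mprodXnE; congr (_ *: 'X_[_]).
by rewrite [RHS]multinomUE_id; apply: eq_bigr => i _; rewrite mulmnE mulnC.
Qed.

Lemma rescale1X K m : rescale K (fun=> 1) 'X_[m] = 'X_[m *+ K].
Proof.
by rewrite rescaleX mevalX big1 ?scale1r // => i _; rewrite expr1n.
Qed.

Lemma rescale_meval K h f z :
  (rescale K h f).@[z] = f.@[fun i => h i * z i ^+ K].
Proof.
rewrite /rescale comp_mpoly_meval; apply: meval_eq => i.
by rewrite tnth_mktuple mevalZ rmorphXn /= mevalXU.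
Qed.

Lemma rescale_comp K L h (g : 'I_n -> R) f :
  rescale K h (rescale L g f) = rescale (L * K) (fun i => g i * h i ^+ L) f.
Proof.
move: f; apply: mpoly_linear_ext; [|exact: rescale_linear|].
  by move=> k f f'; rewrite !rescale_linear.
move=> m; rewrite !rescaleX rescaleZ rescaleX scalerA.
have -> : (m *+ (L * K) = m *+ L *+ K)%MM.
  by apply/mnmP => i; rewrite !mulmnE mulnA.
congr (_ *: _); rewrite !mevalX -big_split /=; apply: eq_bigr => i _.
by rewrite exprMn mulmnE -exprM mulnC.
Qed.

(** The monomials u and v get multiplied by the constants a and c, which amounts to
    a congruence of the matrix X by the diagonal matrix D. *)
Lemma sobs_rescale M K h f :
  sobs M f -> sobs [seq (m *+ K)%MM | m <- M] (rescale K h f).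
Proof.
elim=> [|{}f X u v _ IH Xpsd uM vM]; first by rewrite rescale0; exact: sobs0.
rewrite rescaleD; set a := 'X_[u].@[h]; set c := 'X_[v].@[h].
pose D : 'M[R]_2 := diag_mx (\row_j (if j == 0 then a else c)).
have DE i j : (D *m X *m D) i j = D i i * X i j * D j j.
  rewrite mul_mx_diag mul_diag_mx !mxE !eqxx !mulr1n.
  by [].
have -> : rescale K h (binom X u v) = binom (D *m X *m D) (u *+ K) (v *+ K).
  rewrite /binom !rescaleD !rescaleZ !rescaleX !DE !mxE /= !mulr1n.
  have DK m m' : (m *+ K + m' *+ K = (m + m') *+ K)%MM.
    by apply/mnmP => i; rewrite !(mnmDE, mulmnE) mulnDl.
  rewrite !DK !mpolyXD !mevalM -/a -/c !scalerA.
  by congr (_ *: _ + _ *: _ + _ *: _); ring.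
have scaled m : m \in M -> (m *+ K)%MM \in [seq (m *+ K)%MM | m <- M].
  by move=> mM; apply/mapP; exists m.
apply: sobsDbinom; rewrite ?scaled //; split=> [|w].
  have DT : D^T = D by rewrite tr_diag_mx.
  by case: Xpsd => Xsym _; rewrite !trmx_mul DT Xsym mulmxA.
case: Xpsd => _ /(_ (w *m D)).
by rewrite trmx_mul tr_diag_mx !mulmxA.
Qed.

(** After substituting a suitable power of each variable, f is a sum of binomial
    squares; in other words, fractional exponents are allowed. *)
Definition eventually_sobs f := exists2 K, (0 < K)%N &
  exists M, sobs M (rescale K (fun=> 1) f).

Lemma rescale1_comp K L f :
  rescale K (fun=> 1) (rescale L (fun=> 1) f) = rescale (L * K) (fun=> 1) f.
Proof.
rewrite rescale_comp; congr rescale.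
by apply/funext => i; rewrite expr1n mulr1.
Qed.

Lemma sobs_rescaleM K L M f : sobs M (rescale K (fun=> 1) f) ->
  sobs [seq (m *+ L)%MM | m <- M] (rescale (K * L) (fun=> 1) f).
Proof. by rewrite -rescale1_comp; exact: sobs_rescale. Qed.

Lemma eventually_sobs_common (s : seq {mpoly R[n]}) :
  (forall f, f \in s -> eventually_sobs f) ->
  exists2 K, (0 < K)%N &
    exists M, forall f, f \in s -> sobs M (rescale K (fun=> 1) f).
Proof.
elim: s => [|f s IHs] hs; first by exists 1%N => //; exists [::].
have [|K K0 [M hM]] := IHs; first by move=> g gs; apply: hs; rewrite inE gs orbT.
have [|L L0 [N hN]] := hs f; first by rewrite mem_head.
exists (L * K)%N; first by rewrite muln_gt0 L0.
exists ([seq (m *+ K)%MM | m <- N] ++ [seq (m *+ L)%MM | m <- M]) => g.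
rewrite inE => /predU1P[->|/hM gM].
  by apply: sub_sobs (sobs_rescaleM K hN) => m; rewrite mem_cat => ->.
rewrite mulnC; apply: sub_sobs (sobs_rescaleM L gM) => m.
by rewrite mem_cat => ->; rewrite orbT.
Qed.

Lemma eventually_sobsD f g :
  eventually_sobs f -> eventually_sobs g -> eventually_sobs (f + g).
Proof.
move=> hf hg; have [|K K0 [M hM]] := @eventually_sobs_common [:: f; g].
  by move=> h; rewrite !inE => /orP[] /eqP ->.
exists K => //; exists M; rewrite rescaleD.
by apply: sobsD; apply: hM; rewrite !inE eqxx ?orbT.
Qed.

Lemma eventually_sobs_rescale L f :
  eventually_sobs f -> eventually_sobs (rescale L (fun=> 1) f).
Proof.
move=> [K K0 [M hM]]; exists K => //; exists [seq (m *+ L)%MM | m <- M].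
by rewrite rescale1_comp mulnC; exact: sobs_rescaleM.
Qed.

Lemma eventually_sobs_unscale L f : (0 < L)%N ->
  eventually_sobs (rescale L (fun=> 1) f) -> eventually_sobs f.
Proof.
move=> L0 [K K0 [M]]; rewrite rescale1_comp => hM.
by exists (L * K)%N; [rewrite muln_gt0 L0 | exists M].
Qed.

(** Along an arithmetic progression t of exponents, each second difference of the
    monomials with exponents 2 t_k is the square of x^(t_k) - x^(t_(k+2)), the
    cross term having exponent t_k + t_(k+2) = 2 t_(k+1). Differences of first
    differences telescope into second differences. *)
Lemma second_difference_sobs M (t : nat -> 'X_{1..n}) N :
  (forall k, (k <= N)%N -> t k \in M) ->
  (forall k, (k.+2 <= N)%N -> t k + t k.+2 = t k.+1 + t k.+1)%MM ->
  forall j k, (j <= k)%N -> (k < N)%N ->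
    sobs M (('X_[t k.+1 + t k.+1] - 'X_[t k + t k]) -
            ('X_[t j.+1 + t j.+1] - 'X_[t j + t j])).
Proof.
move=> tM tE j k; elim: k => [|k IHk].
  by rewrite leqn0 => /eqP-> _; rewrite subrr; exact: sobs0.
rewrite leq_eqVlt => /predU1P[-> _|]; first by rewrite subrr; exact: sobs0.
rewrite ltnS => jk kN; set d := (X in _ - X).
have IH := IHk jk (ltnW kN).
have -> : 'X_[t k.+2 + t k.+2] - 'X_[t k.+1 + t k.+1] - d =
    ('X_[t k.+1 + t k.+1] - 'X_[t k + t k] - d) + binom (sym2 1 (-1)) (t k) (t k.+2).
  rewrite /binom !mxE /= tE // !scale1r -opprD scaleNr scalerDl scale1r.
  by ring.
apply: sobsDbinom => //; [|by apply: tM; lia..].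
by apply: sym2_psd; rewrite normrN1.
Qed.

(** Weighted AM-GM for two monomials. The segment from u to v is subdivided into N
    steps, with b at step p. With s_k the monomial at step k,
    (N - p) s_0 + p s_N - N s_p is the double sum over j < p <= k < N of
    (s_(k+1) - s_k) - (s_(j+1) - s_j), and [second_difference_sobs] applies to
    each summand. *)
Lemma two_point_sobs N p u v b : (0 < N)%N -> (p <= N)%N ->
  (u *+ (N - p) + v *+ p = b *+ N)%MM ->
  eventually_sobs ((N - p)%:R *: 'X_[u] + p%:R *: 'X_[v] - N%:R *: 'X_[b]).
Proof.
move=> N0 pN hb; exists (N * 2)%N; first by rewrite muln_gt0 N0.
pose t k := (u *+ (N - k) + v *+ k)%MM.
pose M := [seq t k | k <- iota 0 N.+1]; exists M.
have tM k : (k <= N)%N -> t k \in M.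
  by move=> kN; apply/mapP; exists k; rewrite // mem_iota.
have tE k : (k.+2 <= N)%N -> (t k + t k.+2 = t k.+1 + t k.+1)%MM.
  by move=> kN; apply/mnmP => i; rewrite /t !(mnmDE, mulmnE); nia.
pose s k : {mpoly R[n]} := 'X_[t k + t k].
have -> : rescale (N * 2) (fun=> 1)
    ((N - p)%:R *: 'X_[u] + p%:R *: 'X_[v] - N%:R *: 'X_[b]) =
  \sum_(0 <= j < p) \sum_(p <= k < N) ((s k.+1 - s k) - (s j.+1 - s j)).
  under eq_bigr do rewrite sumrB telescope_sumr // sumr_const_nat.
  rewrite sumrB sumr_const_nat subn0 sumrMnl telescope_sumr //.
  rewrite rescaleB rescaleD !rescaleZ !rescale1X.
  have -> : (u *+ (N * 2) = t 0%N + t 0%N)%MM.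
    by apply/mnmP => i; rewrite /t !(mnmDE, mulmnE); lia.
  have -> : (v *+ (N * 2) = t N + t N)%MM.
    by apply/mnmP => i; rewrite /t !(mnmDE, mulmnE); lia.
  have -> : (b *+ (N * 2) = t p + t p)%MM.
    have /mnmP h := hb; apply/mnmP => i; have := h i.
    by rewrite /t !(mnmDE, mulmnE); lia.
  rewrite -/(s 0%N) -/(s N) -/(s p) !scaler_nat.
  rewrite -[in X in _ - _ *+ X](subnK pN) mulrnDr !mulrnBl.
  by ring.
rewrite big_seq; apply: sobs_sum => j; rewrite mem_index_iota => /andP[_ jp].
rewrite big_seq; apply: sobs_sum => k; rewrite mem_index_iota => /andP[pk kN].
apply: (second_difference_sobs (N := N)) => //.
by rewrite ltnW // (leq_trans jp).
Qed.

(** Weighted AM-GM for finitely many monomials, one point at a time: the barycenter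
    of the points of s replaces them all, and is combined with the head of the
    list by [two_point_sobs]. Multiplying exponents by the total weight L keeps
    every barycenter integral. *)
Lemma weighted_amgm_sobs (s : seq (nat * 'X_{1..n})) :
  let L := (\sum_(a <- s) a.1)%N in
  eventually_sobs (\sum_(a <- s) a.1%:R *: 'X_[a.2 *+ L] -
    L%:R *: 'X_[\sum_(a <- s) a.2 *+ a.1]).
Proof.
elim: s => [|[l a] s IHs] /=.
  rewrite !big_nil scale0r subr0; exists 1%N => //; exists [::].
  by rewrite rescale0; exact: sobs0.
rewrite !big_cons /=.
move: IHs; set L := (\sum_(a <- s) _)%N; set S := (\sum_(a <- s) _)%MM => IHs.
have [L0|L0] := posnP L.
  have h c : c \in s -> c.1 = 0%N.
    move=> cs; apply/eqP; have /eqP := L0.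
    by rewrite sum_nat_seq_eq0 => /allP/(_ c cs).
  have -> : S = 0%MM by rewrite /S big_seq big1 // => c /h->.
  rewrite big_seq big1 ?L0 ?addn0 ?addr0 ?addm0 ?subrr => [|c /h->].
    by exists 1%N => //; exists [::]; rewrite rescale0; exact: sobs0.
  by rewrite scale0r.
apply: (eventually_sobs_unscale L0).
have lL : (0 < l + L)%N by rewrite addn_gt0 L0 orbT.
have h2 := @two_point_sobs (l + L) L (a *+ ((l + L) * L)) (S *+ (l + L))
  ((a *+ l + S) *+ L) lL (leq_addl _ _).
have h1 := eventually_sobs_rescale (l + L) IHs.
have {h1}h2 := eventually_sobsD h1 (h2 _).
rewrite rescaleB rescaleD !rescaleZ !rescale1X rescale_sum.
move: h2; rewrite rescaleB rescaleZ rescale1X rescale_sum addnK.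
under eq_bigr do rewrite rescaleZ rescale1X.
under [X in _ -> eventually_sobs (_ + X - _)]eq_bigr do rewrite rescaleZ rescale1X.
set T1 := \sum_(i <- s) _; set T2 := \sum_(i <- s) _.
have -> : T1 = T2.
  apply: eq_bigr => c _; congr (_ *: 'X_[_]).
  by apply/mnmP => i; rewrite !mulmnE -!mulnA [(L * _)%N]mulnC.
have -> : (a *+ (l + L) *+ L = a *+ ((l + L) * L))%MM.
  by apply/mnmP => i; rewrite !mulmnE mulnA.
move=> h2.
pose w : {mpoly R[n]} := L%:R *: 'X_[S *+ (l + L)]; rewrite -/w in h2.
rewrite [_ + T2]addrC -addrA -[T2](subrK w) -addrA [w + _]addrA [w + _]addrC.
by apply: h2; apply/mnmP => i; rewrite !(mnmDE, mulmnE); ring.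
Qed.

Lemma barycentric_amgm_sobs (I : finType) (e : I -> 'X_{1..n}) b (l : I -> nat) :
  (0 < \sum_i l i)%N -> barycentric e b l ->
  eventually_sobs (\sum_i (l i)%:R *: 'X_[e i] - (\sum_i l i)%:R *: 'X_[b]).
Proof.
move=> L0 hl; apply: (eventually_sobs_unscale L0).
have := weighted_amgm_sobs [seq (l i, e i) | i <- index_enum I].
rewrite /= !big_map /= hl rescaleB rescaleZ rescale1X rescale_sum.
by under [X in _ -> eventually_sobs (X - _)]eq_bigr do rewrite rescaleZ rescale1X.
Qed.

(** A point of the closed orthant has K-th roots of its coordinates; evaluate the
    sum of squares there. *)
Lemma eventually_sobs_ge0 f (x : 'I_n -> R) :
  eventually_sobs f -> (forall i, 0 <= x i) -> 0 <= f.@[x].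
Proof.
move=> [K K0 [M hM]] x0.
have /choice [z zx] : forall i, exists z, z ^+ K = x i.
  move=> i; have := x0 i; rewrite le_eqVlt => /predU1P[<-|xi].
    by exists 0; rewrite expr0n gtn_eqF.
  exists (expR (ln (x i) / K%:R)); rewrite -expRM_natl mulrCA divff ?mulr1.
    by rewrite lnK.
  by rewrite pnatr_eq0 -lt0n.
have := sobs_ge0 z hM; rewrite rescale_meval.
by congr (0 <= _); apply: meval_eq => i; rewrite mul1r zx.
Qed.

End BinomialSquares.

(** * Confining negative coefficients to the support *)

Section Elimination.
Variables (R : realType) (n : nat).
Implicit Types (f p q : {mpoly R[n]}) (b m j k : 'X_{1..n}) (S Z : seq 'X_{1..n}).

(** These are the AM/GM polynomials, known in exponential coordinates as AGE
    functions; the only coefficient that may be negative is that of b. *)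
Definition age b p :=
  (forall x : 'I_n -> R, (forall i, 0 < x i) -> 0 <= p.@[x]) /\
  (forall m, m != b -> 0 <= p@_m).

Lemma ageD b p q : age b p -> age b q -> age b (p + q).
Proof.
move=> [p0 pm] [q0 qm]; split=> [x x0|m mb].
  by rewrite mevalD addr_ge0 ?p0 ?q0.
by rewrite mcoeffD addr_ge0 ?pm ?qm.
Qed.

Lemma ageZ b (c : R) p : 0 <= c -> age b p -> age b (c *: p).
Proof.
move=> c0 [p0 pm]; split=> [x x0|m mb]; first by rewrite mevalZ mulr_ge0 ?p0.
by rewrite mcoeffZ mulr_ge0 ?pm.
Qed.

Lemma age0 b : age b 0.
Proof. by split=> [x _|m _]; rewrite ?meval0 ?mcoeff0. Qed.

Lemma age_sum b (I : Type) (s : seq I) (P : pred I) (F : I -> {mpoly R[n]}) :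
  (forall i, P i -> age b (F i)) -> age b (\sum_(i <- s | P i) F i).
Proof. by move=> h; apply: big_ind => //; [exact: age0 | exact: ageD]. Qed.

(** For f = sum_j q_j, the exponent k causes no cancellation: a nonpositive
    coefficient of f at k comes from q_k alone, and a nonnegative one involves no
    negative coefficient of q_k. *)
Definition separated f (q : 'X_{1..n} -> {mpoly R[n]}) S k :=
  (f@_k <= 0 -> forall j, j \in S -> j != k -> (q j)@_k = 0) /\
  (0 <= f@_k -> 0 <= (q k)@_k).

(** Every q_j with a positive coefficient at b absorbs a multiple lam_j of q_b.
    Dividing by t = max(- beta, sigma), where beta < 0 is the coefficient of q_b
    at b and sigma the sum of the others, makes all the coefficients at b of the
    q_j vanish if f_b <= 0, and uses up q_b entirely if f_b >= 0. Coefficients of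
    q_b elsewhere are nonnegative, and vanish wherever a previous step cleared
    them, so earlier separations persist. *)
Lemma eliminate_one S (q : 'X_{1..n} -> {mpoly R[n]}) b : uniq S -> b \in S ->
  (forall j, j \in S -> age j (q j)) ->
  let f := \sum_(j <- S) q j in
  exists q' : 'X_{1..n} -> {mpoly R[n]},
    [/\ forall j, j \in S -> age j (q' j), \sum_(j <- S) q' j = f,
    separated f q' S b &
    forall k, k \in S -> k != b -> separated f q S k -> separated f q' S k].
Proof.
move=> uS bS hq f.
have fb : f@_b = (q b)@_b + \sum_(j <- S | j != b) (q j)@_b.
  by rewrite /f raddf_sum (bigD1_seq b).
set beta := (q b)@_b in fb; set sigma := \sum_(j <- S | _) _ in fb.
have qb0 j : j \in S -> j != b -> 0 <= (q j)@_b.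
  by move=> jS jb; have [_] := hq j jS; apply; rewrite eq_sym.
have sigma0 : 0 <= sigma.
  rewrite /sigma big_seq_cond; apply: sumr_ge0 => j /andP[jS jb]; exact: qb0.
have [beta0|beta0] := leP 0 beta.
  exists q; split=> //; split=> // fb0 j jS jb; apply/eqP.
  have sig : \sum_(j <- S | (j \in S) && (j != b)) (q j)@_b = 0.
    by rewrite -big_seq_cond; apply/eqP; rewrite eq_le sigma0 andbT -/sigma; lra.
  move/eqP: sig; rewrite psumr_eq0 => [|i /andP[]]; last exact: qb0.
  by move/allP => /(_ j jS); rewrite jS jb.
pose t := Num.max (- beta) sigma.
have t0 : 0 < t by rewrite /t lt_max oppr_gt0 beta0.
pose lam j := (q j)@_b / t.
have lam0 j : j \in S -> j != b -> 0 <= lam j.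
  by move=> jS jb; rewrite divr_ge0 ?qb0 // ltW.
have slam : \sum_(j <- S | j != b) lam j = sigma / t by rewrite -mulr_suml.
have st : 0 <= 1 - sigma / t.
  by rewrite subr_ge0 ler_pdivrMr // mul1r /t le_max lexx orbT.
pose q' j := if j == b then (1 - sigma / t) *: q b else q j + lam j *: q b.
have q'b : q' b = (1 - sigma / t) *: q b by rewrite /q' eqxx.
have q'j j : j != b -> q' j = q j + lam j *: q b by rewrite /q' => /negbTE ->.
have cb j : (q j + lam j *: q b)@_b = (q j)@_b * (1 + beta / t).
  by rewrite mcoeffD mcoeffZ -/beta /lam; ring.
have bt : 0 <= 1 + beta / t.
  by rewrite -[beta]opprK mulNr subr_ge0 ler_pdivrMr // mul1r /t le_max lexx.
exists q'; split.
- move=> j jS; have [->|jb] := eqVneq j b; first by rewrite q'b; exact: ageZ (hq b bS).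
  rewrite q'j //; split=> [x x0|m mj].
    rewrite mevalD mevalZ; apply: addr_ge0; first by case: (hq j jS) => h _; exact: h.
    by rewrite mulr_ge0 ?lam0 //; case: (hq b bS) => h _; exact: h.
  have [->|mb] := eqVneq m b; first by rewrite cb mulr_ge0 ?qb0.
  rewrite mcoeffD mcoeffZ; apply: addr_ge0; first by case: (hq j jS) => _; exact.
  by rewrite mulr_ge0 ?lam0 //; case: (hq b bS) => _; exact.
- rewrite /f !(bigD1_seq b) //= q'b.
  rewrite (eq_bigr (fun j => q j + lam j *: q b)) => [|j jb]; last exact: q'j.
  rewrite big_split /= -scaler_suml slam scalerBl scale1r.
  by rewrite [X in _ + X]addrC addrA subrK.
- split=> [fb0 j jS jb|fb0].
    rewrite q'j // cb.
    have -> : t = - beta by rewrite /t max_l //; lra.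
    by rewrite invrN mulrN divff ?lt_eqF // subrr mulr0.
  rewrite q'b mcoeffZ -/beta.
  have tE : t = sigma by rewrite /t max_r //; lra.
  by rewrite -tE divff ?gt_eqF // subrr mul0r.
- move=> k kS kb [h1 h2]; split=> [fk0 j jS jk|fk0].
    have [jb|jb] := eqVneq j b.
      by rewrite jb q'b mcoeffZ h1 ?mulr0 // eq_sym.
    by rewrite q'j // mcoeffD mcoeffZ !h1 // ?mulr0 ?addr0 // eq_sym.
  rewrite q'j // mcoeffD mcoeffZ; apply: addr_ge0; first exact: h2.
  by rewrite mulr_ge0 ?lam0 //; case: (hq b bS) => _; exact.
Qed.

(** Successive application of [eliminate_one] to all the exponents of S. This is
    what confines the summands to the support of f: both conditions hold at an
    exponent of S where f vanishes, which then occurs in no summand. *)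
Lemma eliminate S (q : 'X_{1..n} -> {mpoly R[n]}) : uniq S ->
  (forall j, j \in S -> age j (q j)) ->
  let f := \sum_(j <- S) q j in
  exists q' : 'X_{1..n} -> {mpoly R[n]},
    [/\ forall j, j \in S -> age j (q' j), \sum_(j <- S) q' j = f &
    forall k, k \in S -> separated f q' S k].
Proof.
move=> uS hq f.
suff h Z : {subset Z <= S} -> exists q' : 'X_{1..n} -> {mpoly R[n]},
    [/\ forall j, j \in S -> age j (q' j),
    \sum_(j <- S) q' j = f & forall k, k \in Z -> separated f q' S k].
  exact: h.
elim: Z => [|b Z IHZ] ZS; first by exists q.
have [|q1 [q1age q1f q1Z]] := IHZ; first by move=> k kZ; apply: ZS; rewrite inE kZ orbT.
have bS : b \in S by apply: ZS; rewrite mem_head.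
have [q2 [q2age q2f q2b q2k]] := eliminate_one uS bS q1age.
rewrite q1f in q2f q2b q2k.
exists q2; split=> // k; rewrite inE.
have [->//|kb /= kZ] := eqVneq k b.
apply: q2k => //; last exact: q1Z.
by apply: ZS; rewrite inE kZ orbT.
Qed.

Lemma group_by_index (s : seq ('X_{1..n} * {mpoly R[n]})) S0 :
  (forall a, a \in s -> age a.1 a.2) ->
  exists S (q : 'X_{1..n} -> {mpoly R[n]}),
    [/\ uniq S, {subset S0 <= S}, forall j, j \in S -> age j (q j) &
    \sum_(j <- S) q j = \sum_(a <- s) a.2].
Proof.
move=> hs; pose S := undup (S0 ++ map fst s).
exists S, (fun j => \sum_(a <- s | a.1 == j) a.2); split.
- exact: undup_uniq.
- by move=> k kS0; rewrite mem_undup mem_cat kS0.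
- move=> j _; rewrite big_seq_cond; apply: age_sum => a /andP[sa /eqP <-].
  exact: hs.
rewrite (exchange_big_dep predT) //= big_seq [RHS]big_seq; apply: eq_bigr => a sa.
rewrite big_mkcond (bigD1_seq a.1) ?undup_uniq //=; last first.
  by rewrite mem_undup mem_cat (map_f fst sa) orbT.
rewrite eqxx big1 ?addr0 // => j /negbTE ja.
by rewrite eq_sym ja.
Qed.

End Elimination.

(** * Relative interior of a simplex *)

Section Simplex.
Variables (R : realType) (n : nat).

Lemma sum_enum_val (I : finType) (V : nmodType) (F : I -> V) :
  \sum_(k < #|I|) F (enum_val k) = \sum_i F i.
Proof. by rewrite [RHS](reindex (@enum_val I I)) //; exact/onW_bij/enum_val_bij. Qed.

Lemma pos_lower_bound (I : finType) (l : I -> R) :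
  (forall i, 0 < l i) -> exists2 e, 0 < e & forall i, e <= l i.
Proof.
move=> l0; have s0 : 0 <= \sum_i (l i)^-1.
  by apply: sumr_ge0 => i _; rewrite invr_ge0 ltW.
exists (1 + \sum_i (l i)^-1)^-1; first by rewrite invr_gt0 ltr_pwDl.
move=> i; rewrite -[l i]invrK lef_pV2 ?posrE ?invr_gt0 ?ltr_pwDl //.
rewrite (bigD1 i) //= addrCA lerDl addr_ge0 //.
by apply: sumr_ge0 => j _; rewrite invr_ge0 ltW.
Qed.

Lemma conv_hull_fin (I : finType) (V : lmodType R) (p : I -> V) (l : I -> R)
    (S : set V) :
  (forall i, S (p i)) -> (forall i, 0 <= l i) -> \sum_i l i = 1 ->
  conv_hull S (\sum_i l i *: p i).
Proof.
move=> Sp l0 l1; exists #|I|, (fun k => p (enum_val k)), (fun k => l (enum_val k)).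
split=> //; first by rewrite (sum_enum_val l).
by rewrite (sum_enum_val (fun i => l i *: p i)).
Qed.

Definition affine_combination (I : finType) (V : lmodType R) (p : I -> V) (z : V) :=
  exists2 w : I -> R, \sum_i w i = 1 & z = \sum_i w i *: p i.

Lemma aff_hull_combination (I : finType) (V : lmodType R) (p : I -> V)
    (S : set V) (y : V) :
  (forall z, S z -> affine_combination p z) -> aff_hull S y ->
  affine_combination p y.
Proof.
move=> Sp [k [q [w [qS w1 ->]]]].
have /choice [g gq] : forall j, exists g : I -> R,
    \sum_i g i = 1 /\ q j = \sum_i g i *: p i.
  by move=> j; have [g g1 gq] := Sp _ (qS j); exists g.
exists (fun i => \sum_j w j * g j i).
  rewrite exchange_big /= -w1; apply: eq_bigr => j _.
  by rewrite -mulr_sumr; case: (gq j) => -> _; rewrite mulr1.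
under [RHS]eq_bigr do rewrite scaler_suml.
rewrite exchange_big /=; apply: eq_bigr => j _; case: (gq j) => _ ->.
by rewrite scaler_sumr; apply: eq_bigr => i _; rewrite scalerA.
Qed.

(** Affine independence makes barycentric coordinates linear functions of the
    point, hence continuous; P collects their coefficients, read off a right
    inverse of the matrix whose rows are (1, p_i). *)
Lemma affind_coordinates (I : finType) (p : I -> 'rV[R]_n) :
  affinely_independent p ->
  exists P : 'I_n -> I -> R, forall w : I -> R, \sum_i w i = 0 ->
    forall i, w i = \sum_j (\sum_k w k *: p k) 0 j * P j i.
Proof.
move=> pind.
pose M : 'M[R]_(#|I|, 1 + n) :=
  row_mx (const_mx 1) (\matrix_(k, j) p (enum_val k) 0 j).
have ME (w : 'rV_#|I|) : w *m M = row_mx (const_mx (\sum_i w 0 (enum_rank i)))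
    (\sum_i w 0 (enum_rank i) *: p i).
  rewrite mul_mx_row; congr row_mx; apply/rowP => j.
    rewrite !mxE -(sum_enum_val (fun i => w 0 (enum_rank i))).
    by apply: eq_bigr => k _; rewrite mxE mulr1 enum_valK.
  rewrite !mxE -(sum_enum_val (fun i => w 0 (enum_rank i) *: p i)) summxE.
  by apply: eq_bigr => k _; rewrite !mxE enum_valK.
have Mfree : row_free M.
  apply: inj_row_free => w; rewrite ME -row_mx0 => /eq_row_mx[/rowP/(_ 0) h1 h2].
  rewrite !mxE in h1; apply/rowP => k; rewrite mxE.
  by have := pind _ h1 h2 (enum_val k); rewrite enum_valK.
exists (fun j i => pinvmx M (rshift 1 j) (enum_rank i)) => w w0 i.
pose wv : 'rV[R]_#|I| := \row_k w (enum_val k).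
have wvE j : wv 0 (enum_rank j) = w j by rewrite mxE enum_rankK.
have : wv *m M *m pinvmx M = wv by rewrite -mulmxA mulmxVp // mulmx1.
move=> /rowP/(_ (enum_rank i)); rewrite wvE => <-.
rewrite ME mxE big_split_ord /= big_ord1 row_mxEl mxE.
under eq_bigr do rewrite wvE.
rewrite w0 mul0r add0r; apply: eq_bigr => j _; rewrite row_mxEr.
by under eq_bigr do rewrite wvE.
Qed.

(** Positive barycentric coordinates stay positive under a small move inside the
    affine hull. *)
Lemma relint_simplex (I : finType) (p : I -> 'rV[R]_n) (l : I -> R)
    (S : set 'rV[R]_n) :
  (forall z, S z <-> exists i, z = p i) -> affinely_independent p ->
  (forall i, 0 < l i) -> \sum_i l i = 1 ->
  relint (conv_hull S) (\sum_i l i *: p i).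
Proof.
move=> SE pind l0 l1.
have Sp i : S (p i) by apply/SE; exists i.
split; first by apply: conv_hull_fin => // i; exact: ltW.
have [P hP] := affind_coordinates pind.
have [m m0 hm] := pos_lower_bound l0.
pose C := 1 + \sum_i \sum_j `|P j i|.
have C0 : 0 < C by rewrite ltr_pwDl // sumr_ge0 // => i _; apply: sumr_ge0.
exists (m / C); first by rewrite divr_gt0.
move=> y yS yx.
have comb z : S z -> affine_combination p z.
  case/SE => i ->; exists (fun j => (j == i)%:R).
    by rewrite (bigD1 i) //= eqxx big1 ?addr0 // => j /negbTE ->.
  rewrite (bigD1 i) //= eqxx scale1r big1 ?addr0 // => j /negbTE ->.
  by rewrite scale0r.
have [w w1 yE] : affine_combination p y.
  apply: aff_hull_combination yS => z [k [q [v [qS _ v1 zE]]]].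
  by apply: (aff_hull_combination comb); exists k, q, v.
rewrite yE; apply: conv_hull_fin => // i.
have : w i - l i >= - m.
  have -> : w i - l i = \sum_j (y 0 j - (\sum_k l k *: p k) 0 j) * P j i.
    rewrite (hP (fun i => w i - l i)); last by rewrite sumrB w1 l1 subrr.
    apply: eq_bigr => j _; rewrite yE; congr (_ * _).
    under eq_bigr do rewrite scalerBl.
    by rewrite sumrB !mxE.
  rewrite lerNl; apply: le_trans (ler_norm _) _; rewrite normrN.
  apply: le_trans (ler_norm_sum _ _ _) _.
  apply: (@le_trans _ _ (\sum_j m / C * `|P j i|)).
    by apply: ler_sum => j _; rewrite normrM ler_wpM2r // ltW.
  rewrite -mulr_sumr -mulrA ler_piMr ?(ltW m0) // mulrC ler_pdivrMr // mul1r.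
  rewrite /C (bigD1 i) //= addrCA lerDl addr_ge0 //.
  by apply: sumr_ge0 => k _; apply: sumr_ge0.
have := hm i; lra.
Qed.

End Simplex.

(** * Splitting a one-negative-term form into simplicial ones *)

Section AgeDecomposition.
Variables (R : realType) (n : nat).
Implicit Types (x h : 'I_n -> R) (b m : 'X_{1..n}) (A : {fset 'X_{1..n}}).

Definition diff_poly A (c : A -> R) (d : R) b : {mpoly R[n]} :=
  \sum_(a : A) c a *: 'X_[val a] - d *: 'X_[b].

Lemma diff_poly_meval A (c : A -> R) d b x : (diff_poly c d b).@[x] =
  \sum_(a : A) c a * 'X_[val a].@[x] - d * 'X_[b].@[x].
Proof.
rewrite /diff_poly mevalB mevalZ raddf_sum; congr (_ - _).
by apply: eq_bigr => a _; rewrite /= mevalZ.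
Qed.

Lemma monomial_exp m (y : 'cV[R]_n) :
  'X_[m].@[fun i => expR (y i 0)] = expR (pairing (expt_pt R m) y).
Proof.
rewrite mevalX /pairing !mxE expR_sum; apply: eq_bigr => i _.
by rewrite mxE expRM_natl.
Qed.

Lemma monomial_gt0 m x : (forall i, 0 < x i) -> 0 < 'X_[m].@[x].
Proof. by move=> x0; rewrite mevalX prodr_gt0 // => i _; rewrite exprn_gt0. Qed.

Lemma exp_tight_point_fin (I : finType) (v : I -> 'rV[R]_n) (c : I -> R) (d : R) :
  (forall i, 0 <= c i) ->
  (forall y, d <= \sum_i c i * expR (pairing (v i) y)) ->
  exists (y : 'cV_n) (w : I -> R),
    [/\ forall i, 0 <= w i, forall i, w i <= c i * expR (pairing (v i) y),
        \sum_i w i *: v i = 0 & d <= \sum_i w i].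
Proof.
move=> c0 hd.
have [|y|y [w [w0 wc wv wd]]] := @exp_tight_point R n #|I|
  (fun k => v (enum_val k)) (fun k => c (enum_val k)) d.
- by [].
- by rewrite (sum_enum_val (fun i => c i * expR (pairing (v i) y))).
exists y, (fun i => w (enum_rank i)); split.
- by [].
- by move=> i; have := wc (enum_rank i); rewrite enum_rankK.
- rewrite -[RHS]wv -(sum_enum_val (fun i => w (enum_rank i) *: v i)).
  by apply: eq_bigr => k _; rewrite enum_valK.
- rewrite -(sum_enum_val (fun i => w (enum_rank i))).
  by under eq_bigr do rewrite enum_valK.
Qed.

(** At a tight point y the terms w_a sum to at least d and have barycenter b.
    Scaling w down to have sum d and writing it as a combination of the fixed
    simplicial weights l T splits the form, up to leftover monomials with
    nonnegative coefficients, into multiples of the AM-GM forms of the l T, all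
    composed with the same diagonal scaling h = exp(- y). *)
Lemma age_simplicial A b (l : {set A} -> A -> nat) (c : A -> R) (d : R) :
  (forall w : A -> R, (forall a, 0 <= w a) ->
     \sum_a w a *: (expt_pt R (val a) - expt_pt R b) = 0 ->
     exists2 k : {set A} -> R, forall T, 0 <= k T &
       forall a, w a = \sum_T k T * (l T a)%:R) ->
  (forall a, 0 <= c a) -> 0 <= d ->
  (forall x, (forall i, 0 < x i) -> 0 <= (diff_poly c d b).@[x]) ->
  exists (h : 'I_n -> R) (k : {set A} -> R),
    [/\ forall i, 0 < h i, forall T, 0 <= k T,
        forall a, \sum_T k T * ((l T a)%:R * 'X_[val a].@[h]) <= c a &
        d = \sum_T k T * ((\sum_a l T a)%:R * 'X_[b].@[h])].
Proof.
move=> hl c0 d0 hpos.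
have [] := @exp_tight_point_fin A (fun a => expt_pt R (val a) - expt_pt R b) c d c0.
  move=> y; have := hpos (fun i => expR (y i 0)) (fun i => expR_gt0 _).
  rewrite diff_poly_meval subr_ge0 monomial_exp.
  rewrite -ler_pdivlMr ?expR_gt0 // mulr_suml => /le_trans; apply.
  apply: ler_sum => a _; rewrite monomial_exp pairingBl expRD expRN.
  by rewrite -mulrA.
move=> y [w [w0 wc wker wd]].
pose s := \sum_a w a.
have s0 : 0 <= s by apply: sumr_ge0.
pose th := d / s.
have ths : th * s = d.
  rewrite /th; have [s00|sN0] := eqVneq s 0; last by rewrite divfK.
  by rewrite s00 mulr0; apply/eqP; rewrite eq_le d0 -s00.
have th0 : 0 <= th by rewrite divr_ge0.
have th1 : th <= 1.
  have [s00|sN0] := eqVneq s 0; first by rewrite /th s00 invr0 mulr0.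
  by rewrite ler_pdivrMr ?mul1r // lt_neqAle eq_sym sN0.
have [|| k k0 kw] := hl (fun a => th * w a).
- by move=> a; rewrite mulr_ge0.
- by under eq_bigr do rewrite -scalerA; rewrite -scaler_sumr wker scaler0.
pose h i := expR ((- y) i 0).
have hE m : 'X_[m].@[h] = (expR (pairing (expt_pt R m) y))^-1.
  by rewrite monomial_exp -scaleN1r pairingZr mulN1r expRN.
exists h, (fun T => k T * expR (pairing (expt_pt R b) y)); split.
- by move=> i; exact: expR_gt0.
- by move=> T; rewrite mulr_ge0 // expR_ge0.
- move=> a; rewrite hE.
  have -> : \sum_T k T * expR (pairing (expt_pt R b) y) *
      ((l T a)%:R / expR (pairing (expt_pt R (val a)) y)) =
      th * w a * (expR (pairing (expt_pt R b) y) / expR (pairing (expt_pt R (val a)) y)).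
    by rewrite kw mulr_suml; apply: eq_bigr => T _; ring.
  rewrite mulrA ler_pdivrMr ?expR_gt0 // -ler_pdivlMr ?expR_gt0 //.
  apply: le_trans (_ : w a <= _); first by rewrite ler_piMl.
  by have := wc a; rewrite pairingBl expRD expRN mulrA.
- rewrite hE -ths /s mulr_sumr; under eq_bigr do rewrite kw.
  rewrite exchange_big /=; apply: eq_bigr => T _.
  by rewrite -mulr_sumr -natr_sum; field; rewrite gt_eqF ?expR_gt0.
Qed.

End AgeDecomposition.

(** * Nonnegative circuits from simplicial forms *)

Section SoncOfAge.
Variables (R : realType) (n : nat).
Implicit Types (h : 'I_n -> R) (b m : 'X_{1..n}) (A B : {fset 'X_{1..n}}).
Implicit Types (f g : {mpoly R[n]}).

Lemma sum_fsubset (V : nmodType) A B (F : 'X_{1..n} -> V) :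
  (B `<=` A)%fset -> (forall m, m \in A -> m \notin B -> F m = 0) ->
  \sum_(t : B) F (val t) = \sum_(a : A) F (val a).
Proof.
move=> BA F0.
have E (X : {fset 'X_{1..n}}) : \sum_(t : X) F (val t) = \sum_(m <- X) F m.
  by rewrite big_seq_fsetE.
by rewrite !E; exact: big_fset_incl.
Qed.

Lemma even_monomial_norm m (x : 'I_n -> R) : even_expt m ->
  'X_[m].@[fun i => `|x i|] = 'X_[m].@[x].
Proof.
move=> me; rewrite !mevalX; apply: eq_bigr => i _.
by rewrite -normrX ger0_norm // exprn_even_ge0.
Qed.

Lemma monomial_norm m (x : 'I_n -> R) :
  'X_[m].@[fun i => `|x i|] = `|'X_[m].@[x]|.
Proof. by rewrite !mevalX normr_prod; apply: eq_bigr => i _; rewrite normrX. Qed.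

Lemma monomialM m (x y : 'I_n -> R) :
  'X_[m].@[fun i => x i * y i] = 'X_[m].@[x] * 'X_[m].@[y].
Proof. by rewrite !mevalX -big_split /=; apply: eq_bigr => i _; rewrite exprMn. Qed.

(** Passing from x to |x| changes no even monomial and replaces d x^b by an upper
    bound, up to the size of d; at |x| the AM-GM form is nonnegative. *)
Lemma simplicial_nonneg A b (l : A -> nat) h (k d : R) :
  (forall a, a \in A -> even_expt a) ->
  barycentric val b l -> (0 < \sum_a l a)%N -> (forall i, 0 < h i) -> 0 <= k ->
  `|d| <= k * ((\sum_a l a)%:R * 'X_[b].@[h]) ->
  nonneg (diff_poly (fun a : A => k * ((l a)%:R * 'X_[val a].@[h])) d b).
Proof.
move=> hA lb L0 h0 k0 hd x.
have hx0 i : 0 <= h i * `|x i| by rewrite mulr_ge0 // ltW.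
have := eventually_sobs_ge0 (barycentric_amgm_sobs R L0 lb) hx0.
rewrite -[X in _ <= X.@[_] -> _]/(diff_poly (fun a => (l a)%:R) (\sum_a l a)%:R b).
rewrite !diff_poly_meval => /(mulr_ge0 k0); rewrite mulrBr mulr_sumr => h1.
apply: le_trans h1 _; apply: lerB.
  apply: ler_sum => a _.
  by rewrite monomialM even_monomial_norm ?mulrA //; exact/hA/fsvalP.
rewrite monomialM monomial_norm; apply: le_trans (ler_norm _) _.
by rewrite normrM !mulrA ler_wpM2r // -!mulrA.
Qed.

(** The circuit is supported on T, which becomes a finite set B of exponents; sums
    over A and over B agree since c and l vanish outside T. *)
Lemma simplicial_circuit A b (T : {set A}) (l : A -> nat) (c : A -> R) (d : R) :
  (forall a, a \in A -> even_expt a) ->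
  barycentric val b l -> (0 < \sum_a l a)%N ->
  affind_on val R T -> (forall a, (0 < l a)%N = (a \in T)) ->
  (forall a, a \in T -> 0 < c a) -> (forall a, a \notin T -> c a = 0) ->
  circuit (diff_poly c d b).
Proof.
move=> hA lb L0 Tind lT cpos c0.
pose ext (V : Type) (F : A -> V) (v0 : V) (m : 'X_{1..n}) :=
  if insub m is Some a then F a else v0.
have extE V (F : A -> V) v0 (a : A) : ext V F v0 (val a) = F a by rewrite /ext valK.
pose P (m : 'X_{1..n}) : bool := ext bool (fun a => a \in T) false m.
pose B := [fset m in A | P m]%fset.
have BA : (B `<=` A)%fset by apply/fsubsetP => m; rewrite !inE => /andP[].
have inB (a : A) : (val a \in B) = (a \in T).
  by rewrite !inE /= fsvalP /= /P extE.
have sumB (V : nmodType) (F : 'X_{1..n} -> V) :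
    (forall a : A, a \notin T -> F (val a) = 0) ->
    \sum_(t : B) F (val t) = \sum_(a : A) F (val a).
  move=> F0; apply: sum_fsubset => // m mA mB.
  by have := F0 [` mA]%fset; apply; rewrite -inB.
pose up (t : B) : A := [` fsubsetP BA _ (valP t)]%fset.
have upE t : val (up t) = val t by [].
have upT t : up t \in T by rewrite -inB upE fsvalP.
have Bind : affinely_independent (fun t : B => expt_pt R (val t)).
  move=> w w0 wp t.
  pose W (m : 'X_{1..n}) : R := if insub m is Some t then w t else 0.
  have WE (t' : B) : W (val t') = w t' by rewrite /W valK.
  have W0 (a : A) : a \notin T -> W (val a) = 0.
    by rewrite -inB /W => ?; rewrite insubN.
  rewrite -WE -upE; apply: (Tind (fun a => W (val a))).
  - exact: W0.
  - by rewrite -(sumB _ W) // -[RHS]w0; apply: eq_bigr => t' _; rewrite WE.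
  - rewrite -(sumB _ (fun m => W m *: expt_pt R m)).
      by rewrite -[RHS]wp; apply: eq_bigr => t' _; rewrite WE.
    by move=> a /W0 ->; rewrite scale0r.
exists B, (fun t => ext R c 0 (val t)), d, b; split.
- by move=> a /(fsubsetP BA); exact: hA.
- exact: Bind.
- by move=> t; rewrite -upE extE cpos.
- pose lam (m : 'X_{1..n}) : R := (ext nat l 0%N m)%:R / (\sum_a l a)%:R.
  have L0R : (\sum_a l a)%:R != 0 :> R by rewrite pnatr_eq0 -lt0n.
  have l0 (a : A) : a \notin T -> ext nat l 0%N (val a) = 0%N.
    by rewrite extE -lT lt0n negbK => /eqP.
  have -> : expt_pt R b = \sum_(t : B) lam (val t) *: expt_pt R (val t).
    rewrite (sumB _ (fun m => lam m *: expt_pt R m)) => [|a /l0]; last first.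
      by rewrite /lam => ->; rewrite mul0r scale0r.
    apply/(scalerI L0R); rewrite scaler_sumr.
    have := kerE (barycentric_real R lb); rewrite -natr_sum => <-.
    apply: eq_bigr => a _; rewrite scalerA /lam extE; congr (_ *: _).
    by rewrite mulrC divfK.
  apply: relint_simplex.
  + move=> z; split=> [[m /= mB <-]|[t ->]]; first by exists [` mB]%fset.
    by exists (val t) => //=; exact: fsvalP.
  + exact: Bind.
  + by move=> t; rewrite /lam -[val t]upE extE divr_gt0 // ltr0n ?lT.
  + rewrite (sumB _ lam) => [|a /l0]; last by rewrite /lam => ->; rewrite mul0r.
    rewrite (eq_bigr (fun a => (l a)%:R / (\sum_a l a)%:R)).
      by rewrite -mulr_suml -natr_sum divff.
    by move=> a _; rewrite /lam extE.
- rewrite /diff_poly; congr (_ - _).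
  rewrite (sumB _ (fun m => ext R c 0 m *: 'X_[m])) => [|a aT].
    by apply: eq_bigr => a _; rewrite extE.
  by rewrite extE c0 // scale0r.
Qed.

Lemma sonc0 : sonc (0 : {mpoly R[n]}).
Proof. by exists [::]; rewrite ?big_nil. Qed.

Lemma soncD f g : sonc f -> sonc g -> sonc (f + g).
Proof.
move=> [s hs ->] [t ht ->]; exists (s ++ t); last by rewrite big_cat.
by move=> p; rewrite mem_cat => /orP[/hs|/ht].
Qed.

Lemma sonc_sum (I : Type) (s : seq I) (P : pred I) (F : I -> {mpoly R[n]}) :
  (forall i, P i -> sonc (F i)) -> sonc (\sum_(i <- s | P i) F i).
Proof. by move=> h; apply: big_ind => //; [exact: sonc0 | exact: soncD]. Qed.

Lemma sonc_nonneg_circuit f : nonneg_circuit f -> sonc f.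
Proof.
by move=> hf; exists [:: f]; rewrite ?big_seq1 // => p; rewrite inE => /eqP->.
Qed.

Lemma sonc_monomial m (c : R) : even_expt m -> 0 <= c -> sonc (c *: 'X_[m]).
Proof. by move=> me c0; apply: sonc_nonneg_circuit; right; exists c, m. Qed.

(** The number d' may have any sign, which covers exponents b that are not even:
    each simplicial piece is scaled by th = d'/d in its last term only, and
    remains nonnegative as |th| <= 1. *)
Lemma age_sonc A b (c : A -> R) (d d' : R) :
  (forall a, a \in A -> even_expt a) ->
  (forall a, 0 <= c a) -> `|d'| <= d ->
  (forall x : 'I_n -> R, (forall i, 0 < x i) -> 0 <= (diff_poly c d b).@[x]) ->
  sonc (diff_poly c d' b).
Proof.
move=> hA c0 d'd hpos.
have d0 : 0 <= d by apply: le_trans d'd.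
have [l lgood ldec] := simplicial_decomposition (val : A -> 'X_{1..n}) b R.
have [h [k [h0 k0 hc hd]]] := age_simplicial ldec c0 d0 hpos.
pose u T := k T * ((\sum_a l T a)%:R * 'X_[b].@[h]).
have Xb0 := monomial_gt0 b h0.
have u0 T : 0 <= u T by rewrite mulr_ge0 // mulr_ge0 // ltW.
pose th := d' / d.
have thd : th * d = d'.
  rewrite /th; have [d00|dN0] := eqVneq d 0; last by rewrite divfK.
  by rewrite d00 mulr0; apply/esym/normr0_eq0/eqP; rewrite eq_le normr_ge0 andbT -d00.
have th1 : `|th| <= 1.
  have [d00|dN0] := eqVneq d 0; first by rewrite /th d00 invr0 mulr0 normr0.
  rewrite normrM normfV (ger0_norm d0) ler_pdivrMr ?mul1r //.
  by rewrite lt_neqAle eq_sym dN0.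
pose p T := diff_poly (fun a : A => k T * ((l T a)%:R * 'X_[val a].@[h])) (th * u T) b.
pose slack a := c a - \sum_T k T * ((l T a)%:R * 'X_[val a].@[h]).
have -> : diff_poly c d' b = \sum_T p T + \sum_(a : A) slack a *: 'X_[val a].
  rewrite /p /diff_poly sumrB -scaler_suml -mulr_sumr -/d.
  rewrite -[\sum_T u T]hd thd addrAC; congr (_ - _).
  rewrite exchange_big -big_split; apply: eq_bigr => a _ /=.
  by rewrite -scaler_suml -scalerDl addrC subrK.
apply: soncD; [apply: sonc_sum => T _ | apply: sonc_sum => a _]; last first.
  by apply: sonc_monomial; [exact/hA/fsvalP | rewrite subr_ge0].
have [lb lT] := lgood T.
have [L0|L0] := posnP (\sum_a l T a).
  have lz a : l T a = 0%N.
    by apply/eqP; have /eqP := L0; rewrite sum_nat_eq0 => /forallP/(_ a).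
  rewrite /p /diff_poly /u L0 mul0r !mulr0 scale0r subr0 big1 => [|a _].
    exact: sonc0.
  by rewrite lz mul0r mulr0 scale0r.
have [Tind lsupp] := lT L0.
have [kz|kN0] := eqVneq (k T) 0.
  rewrite /p /diff_poly /u kz mul0r mulr0 scale0r subr0 big1 => [|a _].
    exact: sonc0.
  by rewrite mul0r scale0r.
have kT0 : 0 < k T by rewrite lt_neqAle eq_sym kN0 k0.
apply: sonc_nonneg_circuit; left; split.
  apply: (simplicial_circuit (c := fun a => k T * ((l T a)%:R * 'X_[val a].@[h]))
    _ hA lb L0 Tind lsupp) => a; rewrite -lsupp.
    by move=> la; rewrite !mulr_gt0 ?ltr0n // monomial_gt0.
  by rewrite lt0n negbK => /eqP ->; rewrite mul0r mulr0.
apply: simplicial_nonneg => //.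
by rewrite normrM (ger0_norm (u0 T)) ler_piMl.
Qed.

End SoncOfAge.

(** * Orthant certificates for the SONC cone *)

Section SoncCone.
Variables (R : realType) (n : nat) (A B1 B2 : {fset 'X_{1..n}}).
Implicit Types (b m : 'X_{1..n}) (p f : {mpoly R[n]}).

Definition extend0 (X : {fset 'X_{1..n}}) (c : X -> R) m : R :=
  if insub m is Some a then c a else 0.

Lemma extend0_val (X : {fset 'X_{1..n}}) (c : X -> R) (a : X) : extend0 c (val a) = c a.
Proof. by rewrite /extend0 valK. Qed.

Lemma extend0_notin (X : {fset 'X_{1..n}}) (c : X -> R) m :
  m \notin X -> extend0 c m = 0.
Proof. by move=> mX; rewrite /extend0 insubN. Qed.

Lemma extend0_ge0 (X : {fset 'X_{1..n}}) (c : X -> R) m :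
  (forall a, 0 <= c a) -> 0 <= extend0 c m.
Proof. by move=> c0; rewrite /extend0; case: insub. Qed.

Lemma mcoeff_fset_sum (X : {fset 'X_{1..n}}) (c : X -> R) m :
  (\sum_(a : X) c a *: 'X_[val a] : {mpoly R[n]})@_m = extend0 c m.
Proof.
rewrite raddf_sum /=; under eq_bigr do rewrite mcoeffZ mcoeffX.
have [mX|mX] := boolP (m \in X); last first.
  rewrite extend0_notin // big1 // => a _; case: eqP => [am|_]; rewrite ?mulr0 //.
  by case/negP: mX; rewrite -am; exact: fsvalP.
rewrite -[m]/(val [` mX]%fset) extend0_val (bigD1 [` mX]%fset) //= eqxx mulr1.
rewrite big1 ?addr0 // => a /negbTE am.
suff -> : (val a == m) = false by rewrite mulr0.
by rewrite -am -[RHS](inj_eq val_inj).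
Qed.

Lemma mcoeff_diff_poly (X : {fset 'X_{1..n}}) (c : X -> R) d b m :
  (diff_poly c d b)@_m = extend0 c m - d * (b == m)%:R.
Proof. by rewrite mcoeffB mcoeff_fset_sum mcoeffZ mcoeffX. Qed.

(** A polynomial p is traded for an age polynomial bp.2 with the same even part.
    The other coefficients become nonpositive on B2, of at least the same size,
    and are erased outside B2, where the sum to be decomposed has none. *)
Definition dominated (bp : 'X_{1..n} * {mpoly R[n]}) p :=
  [/\ age bp.1 bp.2,
      forall m, even_expt m -> bp.2@_m = p@_m,
      forall m, ~ even_expt m -> m \notin B2 -> bp.2@_m = 0 &
      forall m, ~ even_expt m -> bp.2@_m <= - `|p@_m| \/ m \notin B2].

(** Changing the sign of one coordinate in which b is odd changes the sign of the
    monomial b and leaves the even monomials alone. *)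
Lemma flip_sign (X : {fset 'X_{1..n}}) (c : X -> R) d b :
  (forall a, a \in X -> even_expt a) -> ~ even_expt b ->
  nonneg (diff_poly c d b) -> forall x : 'I_n -> R, 0 <= (diff_poly c (- d) b).@[x].
Proof.
move=> hX bodd hpos x.
have [i bi] : exists i, odd (b i).
  by apply: contrapT => h; apply: bodd => i; apply/negP => bi; apply: h; exists i.
pose s (j : 'I_n) : R := (-1) ^+ (j == i).
have sE m : 'X_[m].@[s] = (-1) ^+ odd (m i).
  rewrite mevalX (bigD1 i) //= /s eqxx expr1 signr_odd big1 ?mulr1 // => j /negbTE ->.
  by rewrite expr1n.
have := hpos (fun j => s j * x j); rewrite !diff_poly_meval monomialM sE bi expr1.
rewrite mulN1r mulrN mulNr; congr (0 <= _ - _); apply: eq_bigr => a _.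
rewrite monomialM sE; have /negbTE-> := hX _ (fsvalP a) i.
by rewrite expr0 mul1r.
Qed.

Lemma nonneg_circuit_dominated p : nonneg_circuit p -> exists bp, dominated bp p.
Proof.
case=> [[[T [c [d [b [Teven _ c0 _ pE]]]]] ppos]|[c [a [c0 aeven ->]]]]; last first.
  have odd0 m : ~ even_expt m -> (c *: 'X_[a] : {mpoly R[n]})@_m = 0.
    move=> modd; rewrite mcoeffZ mcoeffX; case: eqP => [am|_]; rewrite ?mulr0 //.
    by case: modd; rewrite -am.
  exists (a, c *: 'X_[a]); split=> //=.
  - split=> [x x0|m _]; first by rewrite mevalZ mulr_ge0 // ltW // monomial_gt0.
    by rewrite mcoeffZ mcoeffX mulr_ge0.
  - by move=> m /odd0.
  - by move=> m /odd0 ->; left; rewrite normr0 oppr0.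
rewrite -/(diff_poly c d b) in pE; rewrite {}pE in ppos *.
have Todd m : ~ even_expt m -> extend0 c m = 0.
  by move=> modd; apply: extend0_notin; apply/negP => /Teven.
have coef0 m : 0 <= extend0 c m by apply: extend0_ge0 => a; rewrite ltW.
have coefne (e : R) m : m != b -> 0 <= (diff_poly c e b)@_m.
  by rewrite mcoeff_diff_poly eq_sym => /negbTE ->; rewrite mulr0 subr0.
case: (pselect (even_expt b)) => [beven|bodd].
  have odd0 m : ~ even_expt m -> (diff_poly c d b)@_m = 0.
    move=> modd; rewrite mcoeff_diff_poly Todd //; case: eqP => [bm|_].
      by case: modd; rewrite -bm.
    by rewrite mulr0 subr0.
  exists (b, diff_poly c d b); split=> //=.
  - by split=> [x _|m]; [exact: ppos | exact: coefne].
  - by move=> m /odd0.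
  - by move=> m /odd0 ->; left; rewrite normr0 oppr0.
have coefeven (e : R) m : even_expt m -> (diff_poly c e b)@_m = (diff_poly c d b)@_m.
  move=> meven; rewrite !mcoeff_diff_poly; case: eqP => [bm|_]; rewrite ?mulr0 //.
  by case: bodd; rewrite bm.
have [bB2|bB2] := boolP (b \in B2).
  exists (b, diff_poly c `|d| b); split=> /=.
  - split=> [x _|m]; last exact: coefne.
    have [d0|d0] := leP 0 d; first by rewrite ger0_norm.
    by rewrite ltr0_norm //; apply: flip_sign.
  - exact: coefeven.
  - move=> m modd mB2; rewrite mcoeff_diff_poly Todd //.
    by case: eqP => [bm|_]; rewrite ?mulr0 ?subr0 //; case/negP: mB2; rewrite -bm.
  - move=> m modd; left; rewrite !mcoeff_diff_poly Todd // !sub0r normrN normrM.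
    by rewrite (@ger0_norm _ (_ %:R)).
exists (b, diff_poly c 0 b); split=> /=.
- split=> [x x0|m]; last exact: coefne.
  rewrite diff_poly_meval mul0r subr0; apply: sumr_ge0 => a _.
  by rewrite mulr_ge0 // ltW // monomial_gt0.
- exact: coefeven.
- by move=> m modd _; rewrite mcoeff_diff_poly Todd // mul0r subrr.
- move=> m modd; have [mB2|] := boolP (m \in B2); [left|by right].
  rewrite !mcoeff_diff_poly Todd // mul0r subrr; case: eqP => [bm|_].
    by case/negP: bB2; rewrite bm.
  by rewrite mulr0 subrr normr0 oppr0.
Qed.

(** B1 + B2 indexes both kinds of exponents at once; parity excludes that an
    exponent is counted twice. *)
Definition signed_index (j : B1 + B2) : 'X_{1..n} :=
  match j with inl b => val b | inr b => val b end.

Hypothesis hA : forall a, a \in A -> even_expt a.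
Hypothesis hB1 : forall b, b \in B1 -> even_expt b.
Hypothesis hB2 : forall b, b \in B2 -> ~ even_expt b.
Hypothesis hAB1 : (A `&` B1)%fset = fset0.

Lemma signed_index_inj : injective signed_index.
Proof.
move=> [b|b] [b'|b'] /= bb'.
- by congr inl; apply/val_inj.
- by case: (hB2 (fsvalP b')); rewrite -bb'; exact/hB1/fsvalP.
- by case: (hB2 (fsvalP b)); rewrite bb'; exact/hB1/fsvalP.
- by congr inr; apply/val_inj.
Qed.

Lemma signed_index_notinA j : signed_index j \notin A.
Proof.
case: j => b /=; apply/negP => bA.
  have : val b \in (A `&` B1)%fset by rewrite in_fsetI bA fsvalP.
  by rewrite hAB1 in_fset0.
by case: (hB2 (fsvalP b)); exact: hA.
Qed.

Variables (c : A -> R) (d1 : B1 -> R) (d2 : B2 -> R).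

Definition signed_coef (j : B1 + B2) : R :=
  match j with inl b => d1 b | inr b => d2 b end.

(** One form per exponent of B1 or B2, supported on A and that exponent, plus
    leftover monomials s. The coefficient t may exceed the absolute value of
    the coefficient of an exponent in B2: on the positive orthant, only its size
    matters. *)
Definition age_certificate (g : B1 + B2 -> A -> R) (s : A -> R) (t : B1 + B2 -> R) :=
  [/\ forall j a, 0 <= g j a, forall a, 0 <= s a,
      forall j (x : 'I_n -> R), (forall i, 0 < x i) ->
        0 <= (diff_poly (g j) (t j) (signed_index j)).@[x],
      forall a, c a = \sum_j g j a + s a &
      forall j, `|signed_coef j| <= t j] /\
  forall b : B1, t (inl b) = d1 b.

Lemma sum_signed (V : nmodType) (F : B1 + B2 -> V) :
  \sum_j F j = \sum_b F (inl b) + \sum_b F (inr b).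
Proof. by rewrite big_sumType. Qed.

Lemma age_certificate_sonc g s t : age_certificate g s t ->
  sonc (signed_poly c d1 d2).
Proof.
move=> [[g0 s0 gt0 cE dt] _].
have -> : signed_poly c d1 d2 =
    \sum_j diff_poly (g j) (signed_coef j) (signed_index j) +
    \sum_(a : A) s a *: 'X_[val a].
  rewrite /diff_poly sumrB (sum_signed (fun j => signed_coef j *: _)) /=.
  rewrite addrAC /signed_poly; congr (_ - _).
  rewrite exchange_big -big_split; apply: eq_bigr => a _ /=.
  by rewrite -scaler_suml -scalerDl -cE.
apply: soncD; apply: sonc_sum => i _.
  by apply: (age_sonc (d := t i)) => //; exact: gt0.
by apply: sonc_monomial => //; exact/hA/fsvalP.
Qed.

Lemma mcoeff_signed_poly m : (signed_poly c d1 d2)@_m =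
  extend0 c m - (extend0 d1 m + extend0 d2 m).
Proof. by rewrite mcoeffB mcoeffD !mcoeff_fset_sum. Qed.

Lemma sum_subseq_le (S : seq 'X_{1..n}) (F : 'X_{1..n} -> R) :
  uniq S -> (forall j, signed_index j \in S) -> (forall i, i \in S -> 0 <= F i) ->
  \sum_j F (signed_index j) <= \sum_(i <- S) F i.
Proof.
move=> uS hS F0; pose S' := [seq signed_index j | j <- index_enum (B1 + B2)%type].
have -> : \sum_j F (signed_index j) = \sum_(i <- S') F i by rewrite big_map.
rewrite [leRHS](bigID (mem S')) /= -[X in _ <= X + _]big_filter.
rewrite (perm_big [seq i <- S | i \in S']) /= ?lerDl.
  by rewrite big_seq_cond; apply: sumr_ge0 => i /andP[/F0].
apply: uniq_perm; rewrite ?filter_uniq //.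
  by rewrite map_inj_uniq ?index_enum_uniq //; exact: signed_index_inj.
move=> i; rewrite mem_filter; case: (boolP (i \in S')) => //= /mapP[j _ ->].
by rewrite hS.
Qed.

(** Each circuit is replaced by an age polynomial as in [dominated]; the sum f of
    these has nonnegative coefficients on A, and nonpositive ones outside A,
    which vanish outside B1 and B2. After grouping by exponent and applying
    [eliminate], the summand of an exponent of B1 or B2 has no other exponent
    outside A, and the remaining summands only contribute nonnegative
    coefficients on A, which make up s. *)
Lemma sonc_age_certificate :
  (forall a, 0 <= c a) -> (forall b : B1, 0 <= d1 b) -> sonc (signed_poly c d1 d2) ->
  exists g s t, age_certificate g s t.
Proof.
move=> c0 d10 [s hs fE].
have /choice [G hG] : forall p, exists bp, nonneg_circuit p -> dominated bp p.
  move=> p; case: (pselect (nonneg_circuit p)) => [/nonneg_circuit_dominated[bp hbp]|np].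
    by exists bp.
  by exists (0%MM, 0).
pose f := \sum_(p <- s) (G p).2.
have fm m : f@_m = \sum_(p <- s) (G p).2@_m by rewrite /f raddf_sum.
have sm m : (signed_poly c d1 d2)@_m = \sum_(p <- s) p@_m by rewrite fE raddf_sum.
have feven m : even_expt m -> f@_m = (signed_poly c d1 d2)@_m.
  move=> meven; rewrite fm sm big_seq [RHS]big_seq; apply: eq_bigr => p ps.
  by case: (hG p (hs p ps)) => _ -> //.
have fodd m : ~ even_expt m -> m \notin B2 -> f@_m = 0.
  move=> modd mB2; rewrite fm big_seq big1 // => p ps.
  by case: (hG p (hs p ps)) => _ _ -> //.
have fB2 m : ~ even_expt m -> m \in B2 -> f@_m <= - `|(signed_poly c d1 d2)@_m|.
  move=> modd mB2; rewrite fm sm; apply: le_trans (_ : \sum_(p <- s) - `|p@_m| <= _).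
    rewrite big_seq [leRHS]big_seq; apply: ler_sum => p ps.
    by case: (hG p (hs p ps)) => _ _ _ /(_ m modd) [//|]; rewrite mB2.
  by rewrite sumrN lerN2 ler_norm_sum.
have B1even m : ~ even_expt m -> extend0 d1 m = 0.
  by move=> modd; apply: extend0_notin; apply/negP => /hB1.
have B2odd m : even_expt m -> extend0 d2 m = 0.
  by move=> meven; apply: extend0_notin; apply/negP => /hB2.
have fA (a : A) : f@_(val a) = c a.
  have aeven : even_expt (val a) by exact/hA/fsvalP.
  rewrite feven // mcoeff_signed_poly extend0_val B2odd // extend0_notin ?addr0 ?subr0 //.
  apply/negP => aB1; have : val a \in (A `&` B1)%fset by rewrite in_fsetI aB1 fsvalP.
  by rewrite hAB1 in_fset0.
have fnA m : m \notin A -> f@_m <= 0.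
  move=> mA; case: (pselect (even_expt m)) => meven.
    rewrite feven // mcoeff_signed_poly extend0_notin // B2odd // addr0 sub0r.
    by rewrite oppr_le0 extend0_ge0.
  have [mB2|mB2] := boolP (m \in B2); last by rewrite fodd.
  by apply: le_trans (fB2 _ meven mB2) _; rewrite oppr_le0.
have [|S [q [uS S0 qage qE]]] := @group_by_index R n [seq G p | p <- s]
  [seq signed_index j | j <- index_enum (B1 + B2)%type].
  by move=> _ /mapP[p ps ->]; case: (hG p (hs p ps)).
rewrite big_map -/f in qE.
have [r [rage rE rsep]] := eliminate uS qage.
rewrite qE in rE rsep.
have jS j : signed_index j \in S.
  by apply: S0; apply/mapP; exists j; rewrite ?mem_index_enum.
have rm m : f@_m = \sum_(j <- S) (r j)@_m by rewrite -rE raddf_sum.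
have r0 m : m \notin A -> forall j, j \in S -> j != m -> (r j)@_m = 0.
  move=> mA j jinS jm; have [mS|mS] := boolP (m \in S).
    by have [h _] := rsep m mS; apply: h => //; exact: fnA.
  have rpos i : i \in S -> 0 <= (r i)@_m.
    by move=> iS; case: (rage i iS) => _; apply; apply: contraNneq mS => ->.
  have := fnA m mA; rewrite rm big_seq => hle.
  have /eqP : \sum_(i <- S | i \in S) (r i)@_m = 0.
    by apply/eqP; rewrite eq_le hle sumr_ge0.
  by rewrite psumr_eq0 // => /allP/(_ j jinS); rewrite jinS => /eqP.
have rj j : (r (signed_index j))@_(signed_index j) = f@_(signed_index j).
  rewrite rm (bigD1_seq (signed_index j)) //= big_seq_cond big1 ?addr0 //.
  move=> i /andP[iS ij]; exact: r0 (signed_index_notinA j) _ iS ij.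
exists (fun j a => (r (signed_index j))@_(val a)).
exists (fun a => c a - \sum_j (r (signed_index j))@_(val a)).
exists (fun j => - (r (signed_index j))@_(signed_index j)).
have notA j (a : A) : val a != signed_index j.
  by apply: contraNneq (signed_index_notinA j) => <-; exact: fsvalP.
have rA (a : A) i : i \in S -> 0 <= (r i)@_(val a).
  move=> iS; have [ia|ia] := eqVneq (val a) i; last by case: (rage i iS) => _; apply.
  rewrite ia; have [_] := rsep i iS; apply.
  by rewrite -ia fA.
have tE (b : B1) : - (r (val b))@_(val b) = d1 b.
  have := rj (inl b); rewrite /= => ->.
  have beven : even_expt (val b) by exact/hB1/fsvalP.
  rewrite feven // mcoeff_signed_poly extend0_val B2odd // extend0_notin.
    by rewrite addr0 sub0r opprK.
  exact: (signed_index_notinA (inl b)).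
split; last by move=> b; exact: tE.
split.
- by move=> j a; exact: rA.
- move=> a; rewrite subr_ge0 -fA rm.
  by apply: (@sum_subseq_le S (fun i => (r i)@_(val a))) => // i; exact: rA.
- move=> j x x0; set b := signed_index j.
  suff -> : diff_poly (fun a : A => (r b)@_(val a)) (- (r b)@_b) b = r b.
    by case: (rage b (jS j)) => h _; exact: h.
  apply/mpolyP => m; rewrite mcoeff_diff_poly mulNr opprK.
  have [mA|mA] := boolP (m \in A).
    rewrite -[m]/(val [` mA]%fset) extend0_val eq_sym (negbTE (notA _ _)).
    by rewrite mulr0 addr0.
  rewrite extend0_notin // add0r; case: eqP => [->|/eqP bm]; first by rewrite mulr1.
  by rewrite mulr0 r0 // jS.
- by move=> a; rewrite addrC subrK.
- case=> b /=; first by rewrite tE ger0_norm.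
  have := rj (inr b); rewrite /= => ->.
  have bodd := hB2 (fsvalP b).
  have := fB2 _ bodd (fsvalP b).
  rewrite mcoeff_signed_poly extend0_val B1even // extend0_notin; last first.
    exact: (signed_index_notinA (inr b)).
  by rewrite sub0r add0r normrN lerNr.
Qed.

End SoncCone.

(** * Lifts given by linear conditions *)

Section LinearLifts.
Variable R : realType.

(** A maximal subspace contained in P is all of P. *)
Lemma subspace_of_pred (V : vectType R) (P : V -> Prop) :
  P 0 -> (forall k u v, P u -> P v -> P (k *: u + v)) ->
  exists L : {vspace V}, forall v, v \in L <-> P v.
Proof.
move=> P0 Plin.
suff h k (L : {vspace V}) : (\dim {: V} - \dim L <= k)%N ->
    (forall v, v \in L -> P v) -> exists L : {vspace V}, forall v, v \in L <-> P v.
  apply: (h _ 0%VS (leqnn _)) => v; rewrite memv0 => /eqP ->; exact: P0.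
elim: k L => [|k IHk] L Lk LP.
  exists L => v; split=> [/LP//|_].
  have /eqP -> : L == fullv.
    by rewrite eqEdim subvf /=; move: Lk; rewrite leqn0 subn_eq0.
  exact: memvf.
case: (pselect (exists2 v, P v & v \notin L)) => [[v Pv vL]|h]; last first.
  exists L => v; split=> [/LP//|Pv]; apply: contrapT => /negP vL.
  by apply: h; exists v.
apply: (IHk (L + <[v]>)%VS).
  have /leq_sub2l : (\dim L < \dim (L + <[v]>))%N.
    rewrite ltnNge; apply: contra vL => dimL.
    have /eqP -> : L == (L + <[v]>)%VS by rewrite eqEdim addvSl dimL.
    exact/(subvP (addvSr _ _))/memv_line.
  move=> /(_ (\dim {: V})) dimL; have := dimvS (subvf L).
  have := dimvS (subvf (L + <[v]>)%VS); lia.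
move=> w /memv_addP[x xL [y /vlineP[k' ->] ->]].
by rewrite addrC; apply: Plin => //; exact: LP.
Qed.

(** Lets a lift be described by a predicate and a plain function, over any finite
    index type, instead of a subspace and a bundled linear map over ordinals. *)
Lemma has_lift_linear (U W : vectType R) (Q : set U) (I : finType)
    (P : {ffun I -> U} -> Prop) (pi : {ffun I -> U} -> W) :
  P 0 -> (forall k u v, P u -> P v -> P (k *: u + v)) -> linear pi ->
  has_lift Q #|I| (pi @` [set u : {ffun I -> U} | (forall i, Q (u i)) /\ P u])%classic.
Proof.
move=> P0 Plin pilin.
pose e (u : {ffun 'I_#|I| -> U}) : {ffun I -> U} := [ffun i => u (enum_rank i)].
have elin k u v : e (k *: u + v) = k *: e u + e v.
  by apply/ffunP => i; rewrite !ffunE.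
have [||L LP] := @subspace_of_pred {ffun 'I_#|I| -> U} (fun u => P (e u)).
- suff -> : e 0 = 0 by [].
  by apply/ffunP => i; rewrite !ffunE.
- by move=> k u v Pu Pv; rewrite elin; exact: Plin.
have pielin : linear (pi \o e) by move=> k u v; rewrite /= elin pilin.
pose f : {linear {ffun 'I_#|I| -> U} -> W} :=
  HB.pack (pi \o e) (GRing.isLinear.Build R _ W _ (pi \o e) pielin).
have fE u : linfun f u = pi (e u) by exact: (lfunE f).
exists L, (linfun f); apply/seteqP; split=> w /=.
  move=> [u [uQ uP] <-]; exists [ffun k => u (enum_val k)]; last first.
    rewrite fE; congr pi; apply/ffunP => i.
    by rewrite !ffunE enum_rankK.
  split=> [i|]; first by rewrite ffunE.
  apply/LP; suff -> : e [ffun k => u (enum_val k)] = u by [].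
  by apply/ffunP => i; rewrite !ffunE enum_rankK.
move=> [u [uQ /LP uP] <-]; exists (e u); last by rewrite fE.
by split=> // i; rewrite ffunE.
Qed.

End LinearLifts.

(** * One exponent bound for all the binomial squares *)

Section AgeSobs.
Variables (R : realType) (n : nat).

(** The forms of the simplicial weights do not depend on the coefficients g and t:
    they form a finite family, and K and M are chosen for that family. Diagonal
    scalings preserve sobs M, so K and M serve all the forms obtained from
    [age_simplicial]. *)
Lemma age_sobs (A : {fset 'X_{1..n}}) (J : finType) (e : J -> 'X_{1..n}) :
  exists2 K : nat, (0 < K)%N & exists M : seq 'X_{1..n},
    forall j (g : A -> R) (t : R), (forall a, 0 <= g a) -> 0 <= t ->
      (forall x : 'I_n -> R, (forall i, 0 < x i) -> 0 <= (diff_poly g t (e j)).@[x]) ->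
      exists g' : A -> R, [/\ forall a, 0 <= g' a, forall a, g' a <= g a &
        sobs M (rescale K (fun=> 1) (diff_poly g' t (e j)))].
Proof.
have /choice [l hl] : forall j, exists l : {set A} -> A -> nat,
  (forall T, barycentric val (e j) (l T)) /\
  forall w : A -> R, (forall a, 0 <= w a) ->
     \sum_a w a *: (expt_pt R (val a) - expt_pt R (e j)) = 0 ->
     exists2 k : {set A} -> R, forall T, 0 <= k T &
       forall a, w a = \sum_T k T * (l T a)%:R.
  move=> j; have [l l1 l2] := simplicial_decomposition (val : A -> 'X_{1..n}) (e j) R.
  by exists l; split=> // T; case: (l1 T).
pose agi (jT : J * {set A}) : {mpoly R[n]} :=
  diff_poly (fun a : A => (l jT.1 jT.2 a)%:R) (\sum_a l jT.1 jT.2 a)%:R (e jT.1).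
have [|K K0 [M hM]] := @eventually_sobs_common R n
  [seq agi jT | jT <- enum {: J * {set A}}].
  move=> _ /mapP[[j T] _ ->]; have [L0|L0] := posnP (\sum_a l j T a).
    have lz a : l j T a = 0%N.
      by apply/eqP; have /eqP := L0; rewrite sum_nat_eq0 => /forallP/(_ a).
    rewrite /agi /= /diff_poly L0 scale0r subr0 big1 => [|a _].
      by exists 1%N => //; exists [::]; rewrite rescale0; exact: sobs0.
    by rewrite lz scale0r.
  by apply: barycentric_amgm_sobs => //; case: (hl j).
exists K => //; exists M => j g t g0 t0 hpos.
have [h [k [h0 k0 hg ht]]] := age_simplicial (proj2 (hl j)) g0 t0 hpos.
have Xpos m : 0 < 'X_[m].@[h] by exact: monomial_gt0.
exists (fun a => \sum_T k T * ((l j T a)%:R * 'X_[val a].@[h])); split=> //.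
  move=> a; apply: sumr_ge0 => T _.
  by rewrite mulr_ge0 // mulr_ge0 // ltW.
(* Scaling by h before the substitution of K-th powers is scaling by a K-th root
   of h after it. *)
have /choice [y yh] : forall i, exists y, y ^+ K = h i.
  move=> i; exists (expR (ln (h i) / K%:R)); rewrite -expRM_natl mulrCA divff ?mulr1.
    by rewrite lnK // posrE.
  by rewrite pnatr_eq0 -lt0n.
have -> : diff_poly (fun a => \sum_T k T * ((l j T a)%:R * 'X_[val a].@[h])) t (e j) =
    \sum_T k T *: rescale 1 h (agi (j, T)).
  have agiE T : k T *: rescale 1 h (agi (j, T)) =
      \sum_(a : A) (k T * ((l j T a)%:R * 'X_[val a].@[h])) *: 'X_[val a] -
      (k T * ((\sum_a l j T a)%:R * 'X_[e j].@[h])) *: 'X_[e j].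
    rewrite rescaleB rescale_sum rescaleZ rescaleX mulm1n scalerBr scaler_sumr.
    rewrite !scalerA !mulrA; congr (_ - _); apply: eq_bigr => a _.
    by rewrite rescaleZ rescaleX mulm1n !scalerA mulrA.
  under [RHS]eq_bigr do rewrite agiE.
  rewrite [RHS]sumrB -scaler_suml -ht exchange_big /=; congr (_ - _).
  by apply: eq_bigr => a _; rewrite scaler_suml.
rewrite rescale_sum; apply: sobs_sum => T _; rewrite rescaleZ.
apply: sobsZ => //.
have hM' := hM (agi (j, T)).
have -> : rescale K (fun=> 1) (rescale 1 h (agi (j, T))) =
    rescale 1 y (rescale K (fun=> 1) (agi (j, T))).
  rewrite !rescale_comp mul1n muln1; congr rescale.
  by apply/funext => i; rewrite expr1 mulr1 mul1r yh.
have {1}-> : M = [seq (m *+ 1)%MM | m <- M].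
  by rewrite (eq_map (@mulm1n n)) map_id.
by apply: sobs_rescale; apply: hM'; rewrite map_f ?mem_enum.
Qed.

End AgeSobs.

(** * The lift *)

Section Lift.
Variables (R : realType) (n : nat) (A B1 B2 : {fset 'X_{1..n}}).
Variables (K : nat) (M : seq 'X_{1..n}).

(** For each j in B1 + B2, the psd matrices of the lift are: one matrix holding t_j
    and the signed coefficient, one holding each coefficient on A, and one for
    each pair of exponents in M. The last summand holds the leftover monomials. *)
Definition block : finType :=
  ((B1 + B2) * option (A + 'I_(size M) * 'I_(size M)) + A)%type.

Implicit Types (u : {ffun block -> 'M[R]_2}) (j : B1 + B2) (a : A).

Definition pair_block u j := u (inl (j, None)).
Definition coef_block u j a := u (inl (j, Some (inl a))).
Definition square_block u j ij := u (inl (j, Some (inr ij))).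
Definition slack_block u a := u (inr a).

Definition lift_poly u j : {mpoly R[n]} :=
  diff_poly (fun a => coef_block u j a 0 0) (pair_block u j 0 0) (signed_index j).

Definition lift_squares u j : {mpoly R[n]} :=
  \sum_ij binom (square_block u j ij) (tnth (in_tuple M) ij.1) (tnth (in_tuple M) ij.2).

(** Equal diagonal entries turn the psd condition on [pair_block] into
    |offdiagonal| <= diagonal. *)
Definition lift_constraint u := forall j,
  pair_block u j 0 0 = pair_block u j 1 1 /\
  rescale K (fun=> 1) (lift_poly u j) = lift_squares u j.

Definition lift_map u : {ffun A -> R^o} * {ffun B1 -> R^o} * {ffun B2 -> R^o} :=
  ([ffun a => \sum_j coef_block u j a 0 0 + slack_block u a 0 0],
   [ffun b => pair_block u (inl b) 0 0],
   [ffun b => pair_block u (inr b) 0 1]).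

Lemma lift_poly_lin k u v j :
  lift_poly (k *: u + v) j = k *: lift_poly u j + lift_poly v j.
Proof.
rewrite /lift_poly /diff_poly /coef_block /pair_block.
rewrite scalerBr scaler_sumr scalerA addrACA -opprD -scalerDl !ffunE !mxE.
congr (_ - _); rewrite -big_split; apply: eq_bigr => a _ /=.
by rewrite !ffunE !mxE scalerA -scalerDl.
Qed.

Lemma lift_squares_lin k u v j :
  lift_squares (k *: u + v) j = k *: lift_squares u j + lift_squares v j.
Proof.
rewrite /lift_squares scaler_sumr -big_split; apply: eq_bigr => ij _ /=.
by rewrite /square_block !ffunE binom_linear.
Qed.

Lemma lift_constraint0 : lift_constraint 0.
Proof.
move=> j; split; first by rewrite /pair_block !ffunE !mxE.
have -> : lift_poly 0 j = 0.
  by have := lift_poly_lin (-1) 0 0 j; rewrite scaler0 add0r scaleN1r addNr.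
have -> : lift_squares 0 j = 0.
  by have := lift_squares_lin (-1) 0 0 j; rewrite scaler0 add0r scaleN1r addNr.
exact: rescale0.
Qed.

Lemma lift_constraint_lin k u v :
  lift_constraint u -> lift_constraint v -> lift_constraint (k *: u + v).
Proof.
move=> hu hv j; have [tu pu] := hu j; have [tv pv] := hv j; split.
  by move: tu tv; rewrite /pair_block !ffunE !mxE => -> ->.
by rewrite lift_poly_lin rescaleD rescaleZ pu pv lift_squares_lin.
Qed.

Lemma lift_map_linear : linear lift_map.
Proof.
move=> k u v; congr ((_, _), _); apply/ffunP => i; rewrite !ffunE.
- rewrite /slack_block !ffunE !mxE scalerDr addrACA; congr (_ + _).
  rewrite scaler_sumr -big_split; apply: eq_bigr => j _ /=.
  by rewrite /coef_block !ffunE !mxE.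
- by rewrite /pair_block !ffunE !mxE.
- by rewrite /pair_block !ffunE !mxE.
Qed.

End Lift.

Theorem theorem1 (R : realType) (n : nat) (A B1 B2 : {fset 'X_{1..n}})
  (hA : forall a, a \in A -> even_expt a)
  (hB1 : forall b, b \in B1 -> conv_expt A (expt_pt R b) /\ even_expt b)
  (hB2 : forall b, b \in B2 -> conv_expt A (expt_pt R b) /\ ~ even_expt b)
  (hAB1 : (A `&` B1)%fset = fset0) :
  exists k : nat, has_lift (psd_cone R 2) k (sonc_cone R A B1 B2).
Proof.
have B1even b : b \in B1 -> even_expt b by case/hB1.
have B2odd b : b \in B2 -> ~ even_expt b by case/hB2.
have [K K0 [M hM]] := age_sobs R A (@signed_index n B1 B2).
exists #|{: block A B1 B2 M}|.
suff -> : sonc_cone R A B1 B2 = (@lift_map R n A B1 B2 M @`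
    [set u : {ffun block A B1 B2 M -> 'M[R]_2} |
      (forall i, psd_cone R 2 (u i)) /\ lift_constraint K u])%classic.
  apply: has_lift_linear; first exact: lift_constraint0.
    exact: lift_constraint_lin.
  exact: lift_map_linear.
apply/seteqP; split=> [[[c d1] d2] /= [c0 d10 hf]|_ [u [upsd uP] <-] /=].
  rewrite /= in c0 d10 hf.
  have [g [s [t [[g0 s0 gpos cE dt] tE]]]] :=
    sonc_age_certificate hA B1even B2odd hAB1 c0 d10 hf.
  have t0 j : 0 <= t j by apply: le_trans (dt j).
  have /choice [g' hg'] j := hM j (g j) (t j) (g0 j) (t0 j) (gpos j).
  have /choice [X hX] : forall j, exists X : 'I_(size M) * 'I_(size M) -> 'M[R]_2,
      (forall ij, psd_cone R 2 (X ij)) /\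
      rescale K (fun=> 1) (diff_poly (g' j) (t j) (signed_index j)) =
      \sum_ij binom (X ij) (tnth (in_tuple M) ij.1) (tnth (in_tuple M) ij.2).
    by move=> j; case: (hg' j) => _ _ /sobs_gram[X X1 X2]; exists X.
  pose w (j : B1 + B2) : R := match j with inl _ => 0 | inr b => d2 b end.
  pose U (i : ((B1 + B2) * option (A + 'I_(size M) * 'I_(size M)) + A)%type) : 'M[R]_2 :=
    match i with
    | inl (j, None) => sym2 (t j) (w j)
    | inl (j, Some (inl a)) => sym2 (g' j a) 0
    | inl (j, Some (inr ij)) => X j ij
    | inr a => sym2 (c a - \sum_j g' j a) 0
    end.
  pose u : {ffun block A B1 B2 M -> 'M[R]_2} := [ffun i : block A B1 B2 M => U i].
  exists u; last first.
    congr ((_, _), _); apply/ffunP => i; rewrite !ffunE.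
    - rewrite /slack_block ffunE mxE /=.
      rewrite (eq_bigr (fun j => g' j i)) => [|j _]; first by rewrite addrC subrK.
      by rewrite /coef_block ffunE mxE.
    - by rewrite /pair_block ffunE mxE /= tE.
    - by rewrite /pair_block ffunE mxE /=.
  split.
    move=> [[j [[a|ij]|]]|a]; rewrite ffunE /=.
    - by apply: sym2_psd; rewrite normr0; case: (hg' j).
    - by case: (hX j).
    - apply: sym2_psd; case: j => b /=; first by rewrite normr0.
      exact: (dt (inr b)).
    - apply: sym2_psd; rewrite normr0 subr_ge0 cE.
      by apply: ler_wpDr => //; apply: ler_sum => j _; case: (hg' j).
  move=> j; split; first by rewrite /pair_block !ffunE !mxE.
  have -> : lift_poly u j = diff_poly (g' j) (t j) (signed_index j).
    rewrite /lift_poly /pair_block /coef_block ffunE !mxE /=.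
    by rewrite /diff_poly; congr (_ - _); apply: eq_bigr => a _; rewrite ffunE mxE.
  case: (hX j) => _ ->; apply: eq_bigr => ij _.
  by rewrite /square_block ffunE.
have u00 i : 0 <= u i 0 0 by exact: psd_diag_ge0.
split=> /= [a|b|].
- by rewrite ffunE; apply: addr_ge0; [apply: sumr_ge0 => j _ |]; exact: u00.
- by rewrite ffunE; exact: u00.
apply: (age_certificate_sonc hA (g := fun j a => coef_block u j a 0 0)
  (s := fun a => slack_block u a 0 0) (t := fun j => pair_block u j 0 0)).
split; last by move=> b; rewrite ffunE.
split.
- by move=> j a; exact: u00.
- by move=> a; exact: u00.
- move=> j x x0; have [_ hj] := uP j.
  rewrite -/(lift_poly u j).
  apply: eventually_sobs_ge0 => [|i]; last exact: ltW.
  exists K => //; exists M; rewrite hj; apply: sobs_sum => ij _.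
  have inM i : tnth (in_tuple M) i \in M by exact: (mem_tnth i (in_tuple M)).
  by apply: sobs_binom => //; exact: upsd.
- by move=> a; rewrite ffunE.
- move=> j; have [h01 _] := uP j.
  case: j h01 => b h01 /=; rewrite ffunE; first by rewrite (ger0_norm (u00 _)).
  exact: psd_offdiag_le (upsd _) h01.
Qed.
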